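(* Let $V:\mathbb{C}\to\mathbb{R}$ be a continuous compactly supported function such that $K=\operatorname{supp}(V)$ is connected. Suppose that there exist a smooth closed simple curve $\Gamma\subset K$ and a constant $\delta>0$ such that $V\geq\delta$ on $\Gamma$ and $\operatorname{supp} V_-$ lies inside $\Gamma$ (i.e. in the bounded component of $\mathbb{C}\setminus\Gamma$), where $V_-=(|V|-V)/2$. Then the Bargmann-Toeplitz operator $T_V$ has only finitely many negative eigenvalues (counted with multiplicities).
   Context: $dm$ is Lebesgue measure on $\mathbb{C}$. The Fock space $\mathcal{F}^2$ is the Hilbert space of entire functions $f$ with $\|f\|_{\mathcal{F}^2}^2=\int_{\mathbb{C}}|f(z)|^2e^{-|z|^2}\,dm(z)<\infty$, and $P_{\mathcal{F}^2}$ is the orthogonal projection in $L^2(\mathbb{C},e^{-|z|^2}dm(z))$ onto $\mathcal{F}^2$. For a bounded compactly supported function $V:\mathbb{C}\to\mathbb{R}$ the Bargmann-Toeplitz operator with symbol $V$ is $T_V:\mathcal{F}^2\to\mathcal{F}^2$, $T_Vf=P_{\mathcal{F}^2}(Vf)$; it is a compact self-adjoint operator with $(T_Vf,f)_{\mathcal{F}^2}=\int_{\mathbb{C}}V(z)|f(z)|^2e^{-|z|^2}\,dm(z)$. *)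

(* Defs.v *)
From HB Require Import structures.
From mathcomp Require Import all_boot all_order all_algebra.
From mathcomp Require Import all_classical all_reals all_analysis.
From mathcomp Require Import complex.

Set Implicit Arguments.
Unset Strict Implicit.
Unset Printing Implicit Defensive.

Import Order.TTheory GRing.Theory Num.Theory.
Import numFieldNormedType.Exports.

Local Open Scope classical_set_scope.
Local Open Scope ring_scope.
Local Open Scope complex_scope.

(* The complex plane is [R[i]].  Its topology, and its structure of normed
   space over itself, are carried by the alias [R[i]^o]; hence the casts to
   [R[i]^o] wherever a topological notion is used. *)

Definition supp (R : realType) (g : R[i] -> R) : set R[i] :=
  closure ([set z | g z != 0] : set R[i]^o).

Definition neg_part (R : realType) (V : R[i] -> R) (z : R[i]) : R :=
  (`|V z| - V z) / 2.

(* [c] is a 1-periodic regular parametrization, injective on a period.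
   Derivatives are taken coordinatewise: [R[i]^o] is normed over [R[i]],
   not over [R]. *)
Definition smooth_closed_simple_curve (R : realType) (Gamma : set R[i]) :=
  exists c : R -> R[i],
    [/\ forall n t, derivable (derive1n n (fun s => complex.Re (c s))) t 1 /\
                    derivable (derive1n n (fun s => complex.Im (c s))) t 1,
        forall t, derive1 (fun s => complex.Re (c s)) t != 0 \/
                  derive1 (fun s => complex.Im (c s)) t != 0,
        forall t, c (t + 1) = c t,
        {in `[0, 1[ &, injective c} &
        Gamma = range c].

(* Points off [Gamma] whose component in the complement is bounded; for a
   Jordan curve there is exactly one such component. *)
Definition inside (R : realType) (Gamma : set R[i]) : set R[i] :=
  [set z | ~ Gamma z /\
    bounded_set (connected_component (~` Gamma : set R[i]^o) z)].

Definition lebesgue2 (R : realType) :=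
  (@lebesgue_measure R \x @lebesgue_measure R)%E.

Definition sqmod (R : realType) (z : R[i]) : R :=
  complex.Re z ^+ 2 + complex.Im z ^+ 2.

Definition gauss (R : realType) (z : R[i]) : R := expR (- sqmod z).

Definition normF2 (R : realType) (f : R[i] -> R[i]) : \bar R :=
  (\int[@lebesgue2 R]_p
     (sqmod (f (p.1 +i* p.2)) * gauss (p.1 +i* p.2))%:E)%E.

Definition Cintegral (R : realType) (g : R[i] -> R[i]) : R[i] :=
  Rintegral (@lebesgue2 R) setT (fun p => complex.Re (g (p.1 +i* p.2))) +i*
  Rintegral (@lebesgue2 R) setT (fun p => complex.Im (g (p.1 +i* p.2))).

Definition dotF (R : realType) (f g : R[i] -> R[i]) : R[i] :=
  Cintegral (fun z => f z * (g z)^* * (gauss z)%:C).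

(* Differentiability over the base field [R[i]], i.e. complex
   differentiability. *)
Definition entire (R : realType) (f : R[i] -> R[i]) :=
  forall z, derivable (f : R[i]^o -> R[i]^o) z 1.

Definition fock (R : realType) : set (R[i] -> R[i]) :=
  [set f | entire f /\ (normF2 f < +oo)%E].

(* Orthogonal projection of [f] onto the Fock space: the [g] in the Fock space
   such that [f - g] is orthogonal to the Fock space; it is meaningful for [f]
   in L^2(C, exp(-|z|^2) dm), and [0] is a dummy value when there is no such
   [g]. *)
Definition fock_proj (R : realType) (f : R[i] -> R[i]) : R[i] -> R[i] :=
  xget (fun=> 0)
    [set g | fock g /\ forall h, fock h -> dotF (fun z => f z - g z) h = 0].

Definition toeplitz (R : realType) (V : R[i] -> R) (f : R[i] -> R[i]) :
    R[i] -> R[i] :=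
  fock_proj (fun z => (V z)%:C * f z).

Definition eigenspaceT (R : realType) (V : R[i] -> R) (l : R[i]) :
    set (R[i] -> R[i]) :=
  [set f | fock f /\ toeplitz V f = (fun z => l * f z)].

Definition eigenvalueT (R : realType) (V : R[i] -> R) (l : R[i]) :=
  exists2 f, eigenspaceT V l f & exists z, f z != 0.

Definition finite_dim (R : realType) (E : set (R[i] -> R[i])) :=
  exists (n : nat) (e : 'I_n -> R[i] -> R[i]),
    forall f, E f -> exists a : 'I_n -> R[i],
      forall z, f z = \sum_(k < n) a k * e k z.

(* On [R[i]], [l < 0] means that [l] is real and negative. *)
Definition finitely_many_negative_eigenvalues (R : realType)
    (V : R[i] -> R) :=
  finite_set [set l : R[i] | l < 0 /\ eigenvalueT V l] /\
  forall l : R[i], l < 0 -> eigenvalueT V l -> finite_dim (eigenspaceT V l).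

(* Main.v *)
(** Let [K] be the support of [V_-], a compact set inside [Gamma], and let [M]
   be the maximum of [|f|] on [Gamma].  By the maximum principle [|f| <= M]
   inside [Gamma], and by Schwarz's lemma [|f|^2 <= e M^2] on [K] as soon as [f]
   vanishes on a fine enough finite net of [K].  On the other hand
   [V >= delta / 2] near [Gamma], so the mean value inequality for [|f|^2] bounds
   the integral of [V_+ |f|^2 e^(-|z|^2)] below by [c M^2].  Hence
   [(T_V f, f) >= 0] for all [f] vanishing on a net of [m] points, and so
   evaluation at these [m] points is injective on the span of the eigenvectors
   with negative eigenvalue.

   The function theory starts from bare complex differentiability.  Goursat's
   lemma gives [f] a primitive [F]; since [F' = f] is differentiable, [F] has
   second-order expansions, so [|F|^2 + eps |z|^2] has no local maximum, which
   gives the maximum principle for [F] and for its difference quotients, hence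
   for their limit [f].  The mean value inequality results from the maximum
   principle for [zeta |-> sum_s f (w + s zeta)^2], with [s] ranging over a finer
   and finer grid. *)

(* Differentiability alone gives expansions with remainder o(|k|), which swamps the gain eps |k|^2
   that excludes a local maximum of |f|^2 + eps |z|^2; a primitive gains one order and repairs this.
   The same obstacle shapes Schwarz's lemma: differentiability of f / (z - p) at a zero p asks for a
   second-order expansion of f, while f^2 / (z - p) has derivative f'(p)^2 there from first-order
   data. Hence the bound on |f|^2 is only linear in |z - p|, which still tends to 0.

   In the mean value inequality, squaring makes |f|^2 the modulus of a differentiable function.
   Turning the grid by zeta on the unit circle keeps the sum comparable to the integral of |f|^2
   over one fixed square, and at zeta = 0 all grid points collapse to w.

   The net depends on V and Gamma but not on f; this uniformity turns positivity into a bound on the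
   number of eigenvalues. The operator enters through the weak identity (V f, h) = l (f, h) for all
   h in the Fock space. *)
Require Import Defs.
From HB Require Import structures.
From mathcomp Require Import all_boot all_order all_algebra.
From mathcomp Require Import all_classical all_reals all_analysis.
From mathcomp Require Import complex.
From mathcomp Require Import measurable_realfun ring lra.

Set Implicit Arguments.
Unset Strict Implicit.
Unset Printing Implicit Defensive.

Import Order.TTheory GRing.Theory Num.Theory.
Import numFieldNormedType.Exports.

Local Open Scope classical_set_scope.
Local Open Scope ring_scope.
Local Open Scope complex_scope.

(** * Signed integrals of continuous functions *)

Section Antiderivative.
Variable R : realType.
Implicit Types (phi P : R -> R) (x y a h : R).
Notation mu := (@lebesgue_measure R).

Lemma continuous_integrable_itv phi x y : continuous phi ->
  mu.-integrable `[x, y] (EFin \o phi).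
Proof.
move=> cphi; apply: continuous_compact_integrable; first exact: segment_compact.
exact: continuous_subspaceT.
Qed.

(** At least one of [I 0 x] and [I x 0] vanishes, so their difference is the signed integral from 0.
    For any [a] to the left of both [x] and 0 it agrees near [x] with [I a y] up to a constant, and
    the fundamental theorem applies with base point [a]. *)
Lemma antiderivative_ex phi : continuous phi ->
  exists P, forall x, is_derive x 1 P (phi x).
Proof.
move=> cphi.
pose I x y := (\int[mu]_(t in `[x, y]) phi t)%R.
have IB x y z : x <= y -> y <= z -> I x z - I x y = I y z.
  move=> xy yz; rewrite /I Rintegral_itvB ?bnd_simp//; last exact: continuous_integrable_itv.
  rewrite Rintegral_itv_obnd_cbnd//.
  apply/integrableS: (continuous_integrable_itv y z cphi) => //.
  by apply: subset_itvr; rewrite bnd_simp.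
exists (fun x => I 0 x - I x 0) => x.
pose a := Num.min x 0 - 1.
have ax : a < x.
  by have : Num.min x 0 <= x by [rewrite ge_min lexx]; rewrite /a; lra.
have a0 : a < 0.
  by have : Num.min x 0 <= 0 by [rewrite ge_min lexx orbT]; rewrite /a; lra.
have E y : a < y -> I 0 y - I y 0 = I a y - I a 0.
  move=> ay; have I0 : I 0 0 = 0 by rewrite /I set_itv1 Rintegral_set1.
  have [y0|y0] := leP y 0.
    have -> : I 0 y = 0.
      move: y0; rewrite le_eqVlt => /orP[/eqP->//|y0].
      by rewrite /I set_itv_ge ?Rintegral_set0// bnd_simp -ltNge.
    by rewrite -(IB a y 0 (ltW ay) y0); lra.
  have -> : I y 0 = 0 by rewrite /I set_itv_ge ?Rintegral_set0// bnd_simp -ltNge.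
  by rewrite subr0 (IB a 0 y (ltW a0) (ltW y0)).
have [dI I'] : derivable (I a) x 1 /\ derive1 (I a) x = phi x.
  apply: (@continuous_FTC1_closed _ phi a x (x + 1)) => //.
  - by rewrite ltrDl.
  - exact: continuous_integrable_itv.
  - exact: cphi.
have dQ : is_derive x 1 (fun y => I a y - I a 0) (phi x).
  rewrite -[phi x]subr0; apply: is_deriveB.
  by apply: (DeriveDef dI); rewrite -derive1E.
apply: (near_eq_is_derive _ dQ).
near=> y; apply/esym/E; rewrite /=; near: y; exact: (lt_nbhsr ax).
Unshelve. all: by end_near. Qed.

(** Fixing one antiderivative makes [oint] additive in the length by mere algebra, for all signs
    ([ointD]). *)
Definition antiderivative phi : R -> R :=
  xget (fun=> 0) [set P | forall x, is_derive x 1 P (phi x)].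

(* The integral from [x] to [x + a], whatever the sign of [a]. *)
Definition oint phi x a := antiderivative phi (x + a) - antiderivative phi x.

Lemma antiderivativeP phi x : continuous phi ->
  is_derive x 1 (antiderivative phi) (phi x).
Proof.
move=> /antiderivative_ex [P HP].
exact: (@xgetPex _ (fun=> 0) [set P | forall x, is_derive x 1 P (phi x)] (ex_intro _ P HP)).
Qed.

Lemma ointD phi x a b : oint phi x (a + b) = oint phi x a + oint phi (x + a) b.
Proof. by rewrite /oint addrA; lra. Qed.

(** The error is [g 1 - g 0], and the derivative of [g] is the pointwise error times [a]: the mean
    value theorem concludes. *)
Lemma oint_affine_le phi x a (al be eta : R) : continuous phi ->
  (forall s : R, 0 <= s <= 1 -> `|phi (x + s * a) - (al + be * (s * a))| <= eta) ->
  `|oint phi x a - (al * a + be * a ^+ 2 / 2)| <= eta * `|a|.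
Proof.
move=> cphi H.
pose g s := antiderivative phi (x + s * a) - (al * (s * a) + be * (s * a) ^+ 2 / 2).
pose dg s := (phi (x + s * a) - (al + be * (s * a))) * a.
have dgP (s : R) : is_derive s 1 g (dg s).
  have dP := antiderivativeP (x + s * a) cphi.
  have da : is_derive s (1:R) (fun s : R => x + s * a) a.
    by apply: is_derive_eq; rewrite /GRing.scale /=; ring.
  have d1 : is_derive s (1:R) (antiderivative phi \o (fun s : R => x + s * a)) (phi (x + s * a) * a).
    exact: (@is_derive1_comp _ (antiderivative phi) (fun s : R => x + s * a)).
  by rewrite /g /dg; apply: is_derive_eq; rewrite /GRing.scale /=; field.
have cg : {within `[0, 1], continuous g}.
  apply: derivable_within_continuous => s _; exact: ex_derive.
have [c] := MVT_segment ler01 (fun s _ => dgP s) cg.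
rewrite in_itv /= => c01; rewrite subr0 mulr1 => gE.
have -> : oint phi x a - (al * a + be * a ^+ 2 / 2) = g 1 - g 0.
  by rewrite /g /oint !mul1r !mul0r expr0n /= addr0; lra.
by rewrite gE /dg normrM ler_wpM2r// H.
Qed.

End Antiderivative.

(** * Modulus and complex differentiability *)

Section Modulus.
Variable R : realType.
Notation nc := (@ComplexField.Normc.normc R).
Implicit Types (z w k : R[i]) (e r : R).

Lemma nc_ge0 z : 0 <= nc z. Proof. by case: z => x y /=; exact: sqrtr_ge0. Qed.
Lemma nc_Re z : `|complex.Re z| <= nc z.
Proof.
case: z => x y /=; rewrite -sqrtr_sqr ler_wsqrtr// lerDl; exact: sqr_ge0.
Qed.
Lemma nc_Im z : `|complex.Im z| <= nc z.
Proof.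
case: z => x y /=; rewrite -sqrtr_sqr ler_wsqrtr// lerDr; exact: sqr_ge0.
Qed.
Lemma nc_sq z : nc z ^+ 2 = sqmod z.
Proof. by case: z => x y /=; rewrite sqr_sqrtr// addr_ge0 ?sqr_ge0. Qed.
Lemma nc_ReIm z : nc z <= `|complex.Re z| + `|complex.Im z|.
Proof.
rewrite -ler_sqr ?nnegrE ?nc_ge0 ?addr_ge0// nc_sq /sqmod sqrrD !real_normK ?num_real//.
have := mulr_ge0 (normr_ge0 (complex.Re z)) (normr_ge0 (complex.Im z)); lra.
Qed.
Lemma ncM z w : nc (z * w) = nc z * nc w.
Proof. exact: ComplexField.Normc.normcM. Qed.
Lemma ncX z n : nc (z ^+ n) = nc z ^+ n.
Proof. by elim: n => [|n IH]; rewrite ?expr0 ?ComplexField.Normc.normc1// !exprS ncM IH. Qed.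
Lemma ncD z w : nc (z + w) <= nc z + nc w.
Proof. exact: (le_normcD z w). Qed.
Lemma ncN z : nc (- z) = nc z.
Proof. exact: (normcN z). Qed.
Lemma ncB z w : nc (z - w) <= nc z + nc w.
Proof. by rewrite -[nc w]ncN ncD. Qed.
Lemma nc0 : nc 0 = 0. Proof. exact: ComplexField.Normc.normc0. Qed.
Lemma nc_real r : nc r%:C = `|r|.
Proof. by rewrite /= expr0n /= addr0 sqrtr_sqr. Qed.
Lemma nc_i : nc 'i = 1.
Proof. by rewrite /= expr0n /= add0r expr1n sqrtr1. Qed.
Lemma nc_gt0 z : (0 < nc z) = (z != 0).
Proof.
rewrite lt_def nc_ge0 andbT; congr (~~ _); apply/eqP/eqP => [/ComplexField.Normc.eq0_normc//|->].
exact: nc0.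
Qed.
Lemma ncV z : nc z^-1 = (nc z)^-1.
Proof. exact: ComplexField.Normc.normcV. Qed.
Lemma nc_sum I (s : seq I) (F : I -> R[i]) : nc (\sum_(i <- s) F i) <= \sum_(i <- s) nc (F i).
Proof.
elim/big_ind2: _ => [|x1 x2 y1 y2 h1 h2|//]; first by rewrite nc0.
by rewrite (le_trans (ncD _ _))// lerD.
Qed.
Lemma norm_nc z : `|z| = (nc z)%:C.
Proof. by case: z => x y; rewrite normc_def. Qed.

(** Radii of balls in [R[i]^o] are elements of [R[i]]; positivity forces them to be real, so
    neighbourhoods can be described by the real-valued modulus. *)
Lemma cnbhsP (z : R[i]^o) (A : set R[i]^o) :
  nbhs z A <-> exists2 r, 0 < r & forall w, nc (w - z) < r -> A w.
Proof.
rewrite -filter_from_ballE; split => [[e /= e0 He]|[r r0 H]].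
  have er : e = (complex.Re e)%:C by rewrite RRe_real// gtr0_real.
  exists (complex.Re e); first by rewrite -ltcR -er.
  move=> w wz; apply: He; rewrite /ball /= er distrC norm_nc ltcR//.
exists r%:C; first by rewrite /= ltcR.
move=> w; rewrite /ball /= distrC norm_nc ltcR; exact: H.
Qed.

Definition ccont (f : R[i] -> R[i]) := forall z e, 0 < e ->
  exists2 r, 0 < r & forall k, nc k < r -> nc (f (z + k) - f z) <= e.

(** Free of division, so that [k = 0] is no exception and the remainder can be integrated along a
    path. *)
Definition cdiff_at (f : R[i] -> R[i]) z := exists d, forall e, 0 < e ->
  exists2 r, 0 < r & forall k, nc k < r -> nc (f (z + k) - f z - d * k) <= e * nc k.

Definition cdiff f := forall z, cdiff_at f z.

Lemma entire_cdiff f : entire f -> cdiff f.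
Proof.
move=> fe z; have [d] := (cvg_ex _).1 (fe z).
move=> /cvgrPdist_le H; exists d => e e0.
have e0' : 0 < e%:C :> R[i] by rewrite ltcR.
have /= := H _ e0'; rewrite near_withinE => /cnbhsP[r r0 Hr]; exists r => // k kr.
have [->|k0] := eqVneq k 0; first by rewrite addr0 mulr0 subrr subr0 nc0 mulr0.
have := Hr k; rewrite subr0 => /(_ kr k0) /=.
rewrite norm_nc lecR => h.
have -> : f (z + k) - f z - d * k = - (d - k^-1 * (f (z + k) - f z)) * k by field.
rewrite ncM ler_wpM2r ?nc_ge0// ncN.
by move: h; rewrite /GRing.scale /= mulr1 [k + z]addrC.
Qed.

Lemma cdiff_ccont f : cdiff f -> ccont f.
Proof.
move=> fd z e e0; have [d Hd] := fd z; have [r r0 H] := Hd 1 ltr01.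
have C0 : 0 < 1 + nc d by rewrite ltr_wpDr ?nc_ge0.
exists (Num.min r (e / (1 + nc d))); first by rewrite lt_min r0 divr_gt0.
move=> k; rewrite lt_min ltr_pdivlMr// => /andP[/H h1 h2].
rewrite -(subrK (d * k) (_ - f z)) (le_trans (ncD _ _))// ncM.
by have := nc_ge0 k; have := nc_ge0 d; lra.
Qed.

Lemma ccont_comp_continuous (f : R[i] -> R[i]) (p : R -> R[i]) (g : R[i] -> R) :
  ccont f -> (forall s t : R, nc (p s - p t) <= `|s - t|) ->
  (forall z w, `|g z - g w| <= nc (z - w)) -> continuous (fun t => g (f (p t))).
Proof.
move=> fc pl gl t; apply/cvgrPdist_le => e e0.
have [r r0 H] := fc (p t) e e0.
exists r => // s /= st; rewrite (le_trans (gl _ _))// -ncN opprB.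
have := H (p s - p t); rewrite [_ + (_ - _)]addrC subrK; apply.
by rewrite (le_lt_trans (pl _ _))// distrC.
Qed.

End Modulus.

Arguments ComplexField.Normc.normc : simpl never.

(** * Path integrals along rectangles and Goursat's lemma *)

Section Goursat.
Variable R : realType.
Notation nc := (@ComplexField.Normc.normc R).
Implicit Types (f : R[i] -> R[i]) (z w k : R[i]) (e r x y a b s t : R).

(* [hseg] and [vseg] integrate [f dz] along a horizontal and a vertical segment of
   signed length; [hvint] and [vhint] along the two L-shaped paths that join
   opposite corners of a rectangle. *)
Definition hseg f x y a : R[i] :=
  oint (fun t => complex.Re (f (t +i* y))) x a +i*
  oint (fun t => complex.Im (f (t +i* y))) x a.

Definition vseg f x y b : R[i] :=
  'i * (oint (fun t => complex.Re (f (x +i* t))) y b +i*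
        oint (fun t => complex.Im (f (x +i* t))) y b).

Definition hvint f x y a b : R[i] := hseg f x y a + vseg f (x + a) y b.
Definition vhint f x y a b : R[i] := vseg f x y b + hseg f x (y + b) a.

Lemma hsegD f x y a a' : hseg f x y (a + a') = hseg f x y a + hseg f (x + a) y a'.
Proof. by rewrite /hseg !ointD. Qed.

Lemma vsegD f x y b b' : vseg f x y (b + b') = vseg f x y b + vseg f x (y + b) b'.
Proof. by rewrite /vseg !ointD -mulrDr. Qed.

Lemma norm_ReB z w : `|complex.Re z - complex.Re w| <= nc (z - w).
Proof. by rewrite -raddfB; exact: nc_Re. Qed.
Lemma norm_ImB z w : `|complex.Im z - complex.Im w| <= nc (z - w).
Proof. by rewrite -raddfB; exact: nc_Im. Qed.

Lemma hline_cont f y (g : R[i] -> R) : ccont f ->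
  (forall z w, `|g z - g w| <= nc (z - w)) -> continuous (fun t => g (f (t +i* y))).
Proof.
move=> fc; apply: (ccont_comp_continuous (p := fun t => t +i* y)) => // s t.
have -> : (s +i* y) - (t +i* y) = (s - t)%:C :> R[i].
  by apply/eqP; rewrite eq_complex /= subrr !eqxx.
by rewrite nc_real.
Qed.

Lemma vline_cont f x (g : R[i] -> R) : ccont f ->
  (forall z w, `|g z - g w| <= nc (z - w)) -> continuous (fun t => g (f (x +i* t))).
Proof.
move=> fc; apply: (ccont_comp_continuous (p := fun t => x +i* t)) => // s t.
have -> : (x +i* s) - (x +i* t) = 'i * (s - t)%:C :> R[i].
  by apply/eqP; rewrite eq_complex /=; apply/andP; split; apply/eqP; ring.
by rewrite ncM nc_i mul1r nc_real.
Qed.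

(** The factor 2 arises because the real and imaginary parts are estimated separately. *)
Lemma line_oint_affine_le f (p : R -> R[i]) x a (al be : R[i]) (eta : R) :
  (forall g : R[i] -> R, (forall z w, `|g z - g w| <= nc (z - w)) ->
     continuous (fun t => g (f (p t)))) ->
  (forall s, 0 <= s <= 1 -> nc (f (p (x + s * a)) - (al + be * (s * a)%:C)) <= eta) ->
  nc ((oint (fun t => complex.Re (f (p t))) x a +i*
       oint (fun t => complex.Im (f (p t))) x a) - (al * a%:C + be * a%:C ^+ 2 / 2))
   <= 2 * eta * `|a|.
Proof.
move=> pc H.
have hRe := @oint_affine_le R _ x a (complex.Re al) (complex.Re be) eta (pc _ norm_ReB).
have hIm := @oint_affine_le R _ x a (complex.Im al) (complex.Im be) eta (pc _ norm_ImB).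
rewrite (le_trans (nc_ReIm _))//.
rewrite (_ : 2 * eta * `|a| = eta * `|a| + eta * `|a|); last by ring.
have E2 : (2 : R[i])^-1 = (2^-1 : R)%:C by rewrite rmorphV ?unitfE ?pnatr_eq0// rmorph_nat.
apply: lerD.
  apply: le_trans (hRe _) => [|s s01].
    rewrite le_eqVlt; apply/orP; left; apply/eqP; congr `| _ |.
    rewrite E2; case: (al) (be) => [a1 a2] [b1 b2]; simpc => /=; ring.
  apply: le_trans (H s s01); apply: le_trans (nc_Re _); rewrite le_eqVlt; apply/orP; left; apply/eqP; congr `| _ |.
  by case: (al) (be) (f _) => [a1 a2] [b1 b2] [f1 f2]; simpc => /=; ring.
apply: le_trans (hIm _) => [|s s01].
  rewrite le_eqVlt; apply/orP; left; apply/eqP; congr `| _ |.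
  rewrite E2; case: (al) (be) => [a1 a2] [b1 b2]; simpc => /=; ring.
apply: le_trans (H s s01); apply: le_trans (nc_Im _); rewrite le_eqVlt; apply/orP; left; apply/eqP; congr `| _ |.
by case: (al) (be) (f _) => [a1 a2] [b1 b2] [f1 f2]; simpc => /=; ring.
Qed.

Lemma hseg_affine_le f x y a (al be : R[i]) (eta : R) : ccont f ->
  (forall s, 0 <= s <= 1 -> nc (f ((x + s * a) +i* y) - (al + be * (s * a)%:C)) <= eta) ->
  nc (hseg f x y a - (al * a%:C + be * a%:C ^+ 2 / 2)) <= 2 * eta * `|a|.
Proof.
move=> fc H; apply: (line_oint_affine_le (p := fun t => t +i* y)) => // g gl.
exact: (@hline_cont f y g fc gl).
Qed.

Lemma vseg_affine_le f x y b (al be : R[i]) (eta : R) : ccont f ->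
  (forall s, 0 <= s <= 1 -> nc (f (x +i* (y + s * b)) - (al + be * (s * b)%:C)) <= eta) ->
  nc (vseg f x y b - 'i * (al * b%:C + be * b%:C ^+ 2 / 2)) <= 2 * eta * `|b|.
Proof.
move=> fc H; rewrite /vseg -mulrBr ncM nc_i mul1r.
apply: (line_oint_affine_le (p := fun t => x +i* t)) => // g gl.
exact: (@vline_cont f x g fc gl).
Qed.

(** The affine model has the primitive al k + be k^2 / 2. On the vertical leg, which starts at
    offset [a], it reads as a function of height with constant term [al + be * a] and slope
    [be * 'i]. *)
Lemma hvint_affine_le f x y a b (al be : R[i]) (eta : R) : ccont f ->
  (forall s t, 0 <= s <= 1 -> 0 <= t <= 1 ->
    nc (f ((x + s * a) +i* (y + t * b)) - (al + be * ((s * a) +i* (t * b)))) <= eta) ->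
  nc (hvint f x y a b - (al * (a +i* b) + be * (a +i* b) ^+ 2 / 2)) <= 2 * eta * (`|a| + `|b|).
Proof.
move=> fc H; rewrite mulrDr.
have h1 := @hseg_affine_le f x y a al be eta fc.
have h2 := @vseg_affine_le f (x + a) y b (al + be * a%:C) (be * 'i) eta fc.
rewrite (_ : hvint _ _ _ _ _ - _ = (hseg f x y a - (al * a%:C + be * a%:C ^+ 2 / 2)) +
  (vseg f (x + a) y b - 'i * ((al + be * a%:C) * b%:C + be * 'i * b%:C ^+ 2 / 2))); last first.
  have -> : a +i* b = a%:C + 'i * b%:C :> R[i] by simpc.
  have i2 := sqr_i R.
  rewrite /hvint; by field: i2.
rewrite (le_trans (ncD _ _))// lerD//.
  apply: h1 => s s01; have := H s 0 s01; rewrite mul0r addr0 => H'.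
  by rewrite [_%:C](_ : _ = (s * a) +i* 0)//; apply: H'; rewrite lexx ler01.
apply: h2 => t t01; have := H 1 t; rewrite !mul1r ler01 lexx => /(_ isT t01).
have -> : a +i* (t * b) = a%:C + 'i * (t * b)%:C :> R[i] by simpc.
by rewrite mulrDr addrA mulrA.
Qed.

Lemma vhint_affine_le f x y a b (al be : R[i]) (eta : R) : ccont f ->
  (forall s t, 0 <= s <= 1 -> 0 <= t <= 1 ->
    nc (f ((x + s * a) +i* (y + t * b)) - (al + be * ((s * a) +i* (t * b)))) <= eta) ->
  nc (vhint f x y a b - (al * (a +i* b) + be * (a +i* b) ^+ 2 / 2)) <= 2 * eta * (`|a| + `|b|).
Proof.
move=> fc H; rewrite mulrDr.
have h1 := @vseg_affine_le f x y b al (be * 'i) eta fc.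
have h2 := @hseg_affine_le f x (y + b) a (al + be * ('i * b%:C)) be eta fc.
rewrite (_ : vhint _ _ _ _ _ - _ =
  (hseg f x (y + b) a - ((al + be * ('i * b%:C)) * a%:C + be * a%:C ^+ 2 / 2)) +
  (vseg f x y b - 'i * (al * b%:C + be * 'i * b%:C ^+ 2 / 2))); last first.
  have -> : a +i* b = a%:C + 'i * b%:C :> R[i] by simpc.
  have i2 := sqr_i R.
  rewrite /vhint; by field: i2.
rewrite (le_trans (ncD _ _))// lerD//.
  apply: h2 => s s01; have := H s 1 s01; rewrite !mul1r ler01 lexx => /(_ isT).
  have -> : (s * a) +i* b = 'i * b%:C + (s * a)%:C :> R[i] by simpc.
  by rewrite mulrDr addrA.
apply: h1 => t t01; have := H 0 t; rewrite !mul0r addr0 ler01 lexx => /(_ isT t01).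
have -> : 0 +i* (t * b) = 'i * (t * b)%:C :> R[i] by simpc.
by rewrite mulrA.
Qed.

Definition rectint f x y a b := hvint f x y a b - vhint f x y a b.

Lemma rectint_split f x y a b :
  rectint f x y (a + a) (b + b) =
  rectint f x y a b + rectint f (x + a) y a b +
  (rectint f x (y + b) a b + rectint f (x + a) (y + b) a b).
Proof.
rewrite /rectint /hvint /vhint !hsegD !vsegD !addrA; ring.
Qed.

(** Both L-shaped paths have the same main term, which cancels. *)
Lemma rectint_affine_le f x y a b (al be : R[i]) (eta : R) : ccont f ->
  (forall s t, 0 <= s <= 1 -> 0 <= t <= 1 ->
    nc (f ((x + s * a) +i* (y + t * b)) - (al + be * ((s * a) +i* (t * b)))) <= eta) ->
  nc (rectint f x y a b) <= 4 * eta * (`|a| + `|b|).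
Proof.
move=> fc H; have h1 := hvint_affine_le fc H; have h2 := vhint_affine_le fc H.
have := le_trans (ncB _ _) (lerD h1 h2).
rewrite opprB addrA subrK /rectint => /le_trans; apply.
by rewrite (_ : 2 * _ * _ + _ = 4 * eta * (`|a| + `|b|))//; ring.
Qed.

End Goursat.

(** * Goursat's lemma, primitives and their second-order expansions *)

Section GoursatTheorem.
Variable R : realType.
Notation nc := (@ComplexField.Normc.normc R).
Implicit Types (f : R[i] -> R[i]) (z w k : R[i]) (e r x y a b s t : R).

(** Nested intervals given by their left ends; the common point is the supremum of these. *)
Lemma nested_halving (s : nat -> R) :
  (forall n, s n <= s n.+1) -> (forall n, s n.+1 + 2^-1 ^+ n.+1 <= s n + 2^-1 ^+ n) ->
  exists l, forall n, s n <= l <= s n + 2^-1 ^+ n.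
Proof.
move=> si sd.
have smono m n : (m <= n)%N -> s m <= s n.
  by move=> /subnK <-; elim: (n - m)%N => [//|k IH]; rewrite addSn (le_trans IH).
have emono m n : (m <= n)%N -> s n + 2^-1 ^+ n <= s m + 2^-1 ^+ m.
  by move=> /subnK <-; elim: (n - m)%N => [//|k IH]; rewrite addSn (le_trans (sd _)).
have bnd m n : s m <= s n + 2^-1 ^+ n.
  have [mn|/ltnW nm] := leqP m n.
    by rewrite (le_trans (smono _ _ mn))// lerDl exprn_ge0// invr_ge0.
  by rewrite (le_trans _ (emono _ _ nm))// lerDl exprn_ge0// invr_ge0.
have hs : has_sup (range s).
  split; first by exists (s 0%N), 0%N.
  by exists (s 0%N + 2^-1 ^+ 0) => _ [m _ <-].
exists (sup (range s)) => n; apply/andP; split.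
  by apply: sup_upper_bound => //; exists n.
by apply: ge_sup => [|_ [m _ <-]//]; exists (s 0%N), 0%N.
Qed.

Section Rectangle.
Variables (f : R[i] -> R[i]) (x y a b : R).
Hypothesis fd : cdiff f.

(** Corners are stored in units of the sides [a] and [b], so that the intervals nest whatever the
    signs of the sides, and also when a side is 0. *)
Let subrect n (p : R * R) :=
  rectint f (x + p.1 * a) (y + p.2 * b) (2^-1 ^+ n * a) (2^-1 ^+ n * b).
Let h n : R := 2^-1 ^+ n.
Let hS n : h n = h n.+1 + h n.+1.
Proof. by rewrite /h exprS; field. Qed.

(** Pigeonhole: one of the four quarters carries at least a quarter of the integral. *)
Let halving n p (c : R) : c / 4 ^+ n <= nc (subrect n p) -> exists q : R * R,
  [/\ p.1 <= q.1, q.1 + h n.+1 <= p.1 + h n, p.2 <= q.2, q.2 + h n.+1 <= p.2 + h n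
    & c / 4 ^+ n.+1 <= nc (subrect n.+1 q)].
Proof.
have h0 : 0 <= h n.+1 by rewrite exprn_ge0// invr_ge0.
set d := c / 4 ^+ n.+1.
have -> : c / 4 ^+ n = d + d + (d + d).
  by rewrite /d exprS; field; rewrite expf_neq0.
have -> : subrect n p =
   subrect n.+1 p + subrect n.+1 (p.1 + h n.+1, p.2) +
  (subrect n.+1 (p.1, p.2 + h n.+1) + subrect n.+1 (p.1 + h n.+1, p.2 + h n.+1)).
  rewrite /subrect /= -!/(h _) (hS n) !(mulrDl (h _)) rectint_split.
  by rewrite !mulrDl !addrA.
move=> H.
have [h1|h1] := leP d (nc (subrect n.+1 p)).
  by exists p; split=> //; rewrite (hS n); lra.
have [h2|h2] := leP d (nc (subrect n.+1 (p.1 + h n.+1, p.2))).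
  by exists (p.1 + h n.+1, p.2); split=> //=; rewrite ?(hS n); lra.
have [h3|h3] := leP d (nc (subrect n.+1 (p.1, p.2 + h n.+1))).
  by exists (p.1, p.2 + h n.+1); split=> //=; rewrite ?(hS n); lra.
have [h4|h4] := leP d (nc (subrect n.+1 (p.1 + h n.+1, p.2 + h n.+1))).
  by exists (p.1 + h n.+1, p.2 + h n.+1); split=> //=; rewrite ?(hS n); lra.
have := le_trans H (le_trans (ncD _ _) (lerD (ncD _ _) (ncD _ _))).
lra.
Qed.

(** The n-th rectangle keeps at least c / 4^n of the integral and lies within [h n * L] of the limit
    point [p]. The expansion at [p] is accurate there to [e * (h n * L)], so the integral is at most
    4 e (h n L)^2. As h n ^2 4^n = 1, this leaves c <= 4 e L^2 for every e > 0. *)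
Lemma goursat : rectint f x y a b = 0.
Proof.
apply: ComplexField.Normc.eq0_normc; set c := nc _.
pose good n p := c / 4 ^+ n <= nc (subrect n p).
pose nxt n p := xget p [set q : R * R |
  [/\ p.1 <= q.1, q.1 + h n.+1 <= p.1 + h n, p.2 <= q.2, q.2 + h n.+1 <= p.2 + h n
    & good n.+1 q]].
pose P := fix P n := if n is m.+1 then nxt m (P m) else (0, 0) : R * R.
have Pgood n : good n (P n).
  elim: n => [|n /halving IH]; last by rewrite /= /nxt; case: xgetP => [q _ []|/(_ _)]//; move: IH => [q Hq] /(_ q).
  rewrite /good expr0 divr1 (_ : subrect _ _ = rectint f x y a b) //.
  by rewrite /subrect expr0 !mul1r; congr rectint; rewrite /= mul0r addr0.
have Pnxt n : [/\ (P n).1 <= (P n.+1).1, (P n.+1).1 + h n.+1 <= (P n).1 + h n,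
    (P n).2 <= (P n.+1).2 & (P n.+1).2 + h n.+1 <= (P n).2 + h n].
  rewrite /= /nxt; case: xgetP => [q _ []|]//.
  by have [q Hq] := halving (Pgood n); move=> /(_ q).
have [s Hs] : exists l, forall n, (P n).1 <= l <= (P n).1 + h n.
  by apply: nested_halving => n; have [] := Pnxt n.
have [t Ht] : exists l, forall n, (P n).2 <= l <= (P n).2 + h n.
  by apply: nested_halving => n; have [] := Pnxt n.
pose p := (x + s * a) +i* (y + t * b).
have [d Hd] := fd p.
set L := `|a| + `|b|.
have L0 : 0 <= L by rewrite addr_ge0.
have fc := cdiff_ccont fd.
suff key e : 0 < e -> c <= 4 * e * L * L.
  apply/eqP; rewrite eq_le nc_ge0 andbT; apply/ler_addgt0Pr => e e0; rewrite add0r.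
  have LL : 0 < 4 * L * L + 1 by rewrite ltr_wpDl// !mulr_ge0.
  have := key (e / (4 * L * L + 1)); rewrite divr_gt0// => /(_ isT) /le_trans; apply.
  rewrite (_ : 4 * _ * L * L = e * ((4 * L * L) / (4 * L * L + 1))); last by ring.
  by rewrite ler_piMr ?(ltW e0)// ler_pdivrMr// mul1r lerDl.
move=> e0; have [r r0 Hr] := Hd e e0.
have [n Hn] : exists n, h n * L < r.
  have Lr : 0 < r / (L + 1) by rewrite divr_gt0// ltr_wpDl.
  have := @cvg_geometric R 1 (2^-1); rewrite ger0_norm ?invr_ge0// => /(_ _).
  have -> : (2^-1 : R) < 1 by rewrite invf_lt1 // ltr1n.
  move=> /(_ isT) /cvgrPdist_lt /(_ _ Lr)[n _ /(_ n (leqnn n))] /=.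
  rewrite sub0r normrN mul1r ger0_norm ?exprn_ge0 ?invr_ge0// ltr_pdivlMr ?ltr_wpDl// => hn.
  exists n; apply: le_lt_trans hn; rewrite ler_wpM2l ?exprn_ge0 ?invr_ge0//.
  by rewrite lerDl.
have h0 : 0 < h n by rewrite exprn_gt0// invr_gt0.
have := Pgood n; rewrite /good ler_pdivrMr ?exprn_gt0// => /le_trans; apply.
pose z := (x + (P n).1 * a) +i* (y + (P n).2 * b).
(* The expansion of [f] at [p] is recentred at the corner [z], where its value is
   [f p + d * (z - p)]. *)
have := @rectint_affine_le R f (x + (P n).1 * a) (y + (P n).2 * b) (h n * a) (h n * b)
  (f p + d * (z - p)) d (e * (h n * L)) fc.
move=> H; rewrite (@le_trans _ _ (4 * (e * (h n * L)) * (`|h n * a| + `|h n * b|) * 4 ^+ n))//.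
  rewrite ler_wpM2r ?exprn_ge0//; apply: H => u v u01 v01.
  pose k := ((((P n).1 - s) + u * h n) * a) +i* ((((P n).2 - t) + v * h n) * b).
  have kE : k = (z - p) + ((u * (h n * a)) +i* (v * (h n * b))).
    by rewrite /k /z /p; simpc; congr (_ +i* _); ring.
  have kL : nc k <= h n * L.
    rewrite (le_trans (nc_ReIm _))//= !normrM mulrDr lerD// ler_wpM2r//.
      by have := Hs n; have : 0 <= u * h n <= h n; [nra|move=> *; rewrite ler_norml; lra].
    by have := Ht n; have : 0 <= v * h n <= h n; [nra|move=> *; rewrite ler_norml; lra].
  have := Hr k (le_lt_trans kL Hn).
  rewrite [X in nc (f X - _)](_ : _ = p + k); last first.
    by rewrite /k /p; simpc; congr (_ +i* _); ring.
  move=> H'; rewrite -[f p + _ + _]addrA -mulrDr -kE opprD addrA (le_trans H')//.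
  by rewrite ler_wpM2l ?(ltW e0).
rewrite !normrM (ger0_norm (ltW h0)) -mulrDr -/L.
rewrite (_ : 4 * _ * _ * _ = 4 * e * L * L * (h n * h n * 4 ^+ n)); last by ring.
rewrite /h -exprMn -exprMn (_ : 2^-1 * 2^-1 * 4 = 1 :> R) ?expr1n ?mulr1//.
by field.
Qed.

End Rectangle.

Definition primitive f z : R[i] := hvint f 0 0 (complex.Re z) (complex.Im z).

(** Goursat on the rectangle with opposite corners (x, 0) and (x + a, y) moves the horizontal leg
    from ordinate 0 to ordinate [y]. *)
Lemma primitiveB f x y a b : cdiff f ->
  primitive f ((x +i* y) + (a +i* b)) - primitive f (x +i* y) = hvint f x y a b.
Proof.
move=> fd; have := goursat x 0 a y fd.
rewrite /rectint /vhint /primitive /hvint /= !add0r hsegD vsegD !add0r => /eqP.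
rewrite subr_eq0 => /eqP E.
have -> : hseg f x 0 a = vseg f x 0 y + hseg f x y a - vseg f (x + a) 0 y by rewrite -E addrK.
ring.
Qed.

Definition taylor2 (G : R[i] -> R[i]) := forall z, exists al d, forall e, 0 < e ->
  exists2 r, 0 < r & forall k, nc k < r -> nc (G (z + k) - G z - al * k - d * k ^+ 2) <= e * nc k ^+ 2.

Lemma box_le a b s t : 0 <= s <= 1 -> 0 <= t <= 1 -> nc ((s * a) +i* (t * b)) <= 2 * nc (a +i* b).
Proof.
move=> /andP[s0 s1] /andP[t0 t1]; rewrite (le_trans (nc_ReIm _))//= !normrM (ger0_norm s0) (ger0_norm t0).
have := nc_Re (a +i* b); have := nc_Im (a +i* b) => /= h1 h2.
have := ler_piMl (normr_ge0 a) s1; have := ler_piMl (normr_ge0 b) t1; lra.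
Qed.

Lemma primitive_taylor2 f : cdiff f -> taylor2 (primitive f).
Proof.
move=> fd [x y]; have [d Hd] := fd (x +i* y); exists (f (x +i* y)), (d / 2) => e e0.
(* The three factors 2 come from [box_le], from [hvint_affine_le] and from
   [|a| + |b| <= 2 * nc (a +i* b)]. *)
have e8 : 0 < e / 8 by rewrite divr_gt0.
have [r r0 Hr] := Hd _ e8; exists (r / 2); first by rewrite divr_gt0.
move=> [a b] kr; have kr2 : 2 * nc (a +i* b) < r by lra.
rewrite primitiveB// -addrA -opprD [d / 2 * _]mulrAC.
have fc := cdiff_ccont fd.
rewrite (le_trans (@hvint_affine_le R f x y a b _ d (e / 8 * (2 * nc (a +i* b))) fc _))//.
  move=> s t s01 t01; have kab := box_le a b s01 t01.
  have := Hr _ (le_lt_trans kab kr2); rewrite opprD addrA => /le_trans; apply.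
  by rewrite ler_wpM2l// ltW.
have := nc_Re (a +i* b); have := nc_Im (a +i* b) => /= h1 h2.
set n := nc _ in h1 h2 *; have n0 : 0 <= n by exact: nc_ge0.
rewrite (_ : 2 * _ * _ = (e * n / 2) * (`|a| + `|b|)); last by field.
have : e * n / 2 * (`|a| + `|b|) <= e * n / 2 * (n + n).
  by rewrite ler_wpM2l ?lerD// divr_ge0 ?mulr_ge0// ltW.
by rewrite (_ : _ * (n + n) = e * n ^+ 2)//; field.
Qed.

Lemma primitive_diff_le f z (eta : R) k : cdiff f ->
  (forall w, nc w <= 2 * nc k -> nc (f (z + w) - f z) <= eta) ->
  nc (primitive f (z + k) - primitive f z - f z * k) <= 4 * eta * nc k.
Proof.
case: z => x y; case: k => a b fd H.
have fc := cdiff_ccont fd.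
have eta0 : 0 <= eta.
  by have := H 0; rewrite addr0 subrr nc0; apply; rewrite mulr_ge0// nc_ge0.
rewrite primitiveB//; have := @hvint_affine_le R f x y a b (f (x +i* y)) 0 eta fc.
rewrite !mul0r addr0 => /(_ _)/le_trans; apply => [s t s01 t01|].
  by rewrite mul0r addr0; exact: (H _ (box_le a b s01 t01)).
have := nc_Re (a +i* b); have := nc_Im (a +i* b) => /= h1 h2.
rewrite (_ : 4 * _ * _ = 2 * eta * (nc (a +i* b) + nc (a +i* b))); last by ring.
by rewrite ler_wpM2l ?lerD// mulr_ge0.
Qed.

End GoursatTheorem.

(** * The maximum principle *)

Section MaximumPrinciple.
Variable R : realType.
Notation nc := (@ComplexField.Normc.normc R).
Implicit Types (f G : R[i] -> R[i]) (K U : set R[i]) (z w k : R[i]) (e r : R).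

(** The square |w + v|^2 is dropped; the cross term of [u] and [v] is a sum of two products, each at
    most [nc u * m] in absolute value. *)
Lemma sqmodD_ge (u v : R[i]) (m : R) : nc v <= m ->
  forall w, sqmod (u + (w + v)) >= sqmod u +
     2 * (complex.Re u * complex.Re w + complex.Im u * complex.Im w) - 4 * nc u * m.
Proof.
move=> vm w; have m0 : 0 <= m := le_trans (nc_ge0 v) vm.
have h1 : `|complex.Re u * complex.Re v| <= nc u * m.
  by rewrite normrM ler_pM ?nc_Re// (le_trans (nc_Re _)).
have h2 : `|complex.Im u * complex.Im v| <= nc u * m.
  by rewrite normrM ler_pM ?nc_Im// (le_trans (nc_Im _)).
move: h1 h2; rewrite /sqmod; case: u {vm} => u1 u2; case: v => v1 v2; case: w => w1 w2 /=.
rewrite !ler_norml => /andP[h1 _] /andP[h2 _].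
have := sqr_ge0 (w1 + v1); have := sqr_ge0 (w2 + v2).
set n := nc _ in h1 h2 *; nra.
Qed.

(* Summing over the four increments [s], [-s], [i s], [-i s] kills the linear and
   the quadratic terms of the expansion of [G]. *)
Lemma taylor2_no_local_max G z (eps r : R) : taylor2 G -> 0 < eps -> 0 < r ->
  exists2 k, nc k < r &
    sqmod (G z) + eps * sqmod z < sqmod (G (z + k)) + eps * sqmod (z + k).
Proof.
move=> HG eps0 r0; have [al [d Hd]] := HG z.
have B0 := nc_ge0 (G z).
(* Small enough for the four remainders, 16 |G z| e s^2 in total, to stay below 4 eps s^2, which is
   what eps |z|^2 gains over the four increments. *)
pose e := eps / (8 * (nc (G z) + 1)).
have e0 : 0 < e by rewrite divr_gt0// mulr_gt0// ltr_wpDl.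
have [r' r'0 Hr] := Hd e e0.
pose s := Num.min r r' / 2.
have s0 : 0 < s by rewrite divr_gt0// lt_min r0.
have sr : s < r by have : Num.min r r' <= r by [rewrite ge_min lexx]; rewrite /s; lra.
have sr' : s < r' by have : Num.min r r' <= r' by [rewrite ge_min lexx orbT]; rewrite /s; lra.
clearbody s.
have step (c : R[i]) : nc c = 1 ->
   sqmod (G z) + 2 * (complex.Re (G z) * complex.Re (al * (c * s%:C) + d * (c * s%:C) ^+ 2) +
      complex.Im (G z) * complex.Im (al * (c * s%:C) + d * (c * s%:C) ^+ 2))
     - 4 * nc (G z) * (e * s ^+ 2) <= sqmod (G (z + c * s%:C)).
  move=> c1; have nk : nc (c * s%:C) = s by rewrite ncM c1 mul1r nc_real gtr0_norm.
  have := Hr (c * s%:C); rewrite nk => /(_ sr') H.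
  have := sqmodD_ge (G z) H (al * (c * s%:C) + d * (c * s%:C) ^+ 2).
  by rewrite (_ : G z + _ = G (z + c * s%:C)) //; ring.
have es : 4 * (4 * nc (G z) * (e * s ^+ 2)) < 4 * eps * s ^+ 2.
  rewrite [ltLHS](_ : _ = 4 * eps * s ^+ 2 * ((4 * nc (G z)) / (8 * (nc (G z) + 1)))).
    rewrite gtr_pMr ?mulr_gt0 ?exprn_gt0//.
    by rewrite ltr_pdivrMr ?mul1r ?mulr_gt0// ?ltr_wpDl//; lra.
  by rewrite /e; field; rewrite gt_eqF// ltr_wpDl.
have nN1 : nc (-1) = 1 by rewrite ncN ComplexField.Normc.normc1.
have nNi : nc (- 'i) = 1 by rewrite ncN nc_i.
have := step 1 (ComplexField.Normc.normc1 R).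
have := step (-1) nN1.
have := step 'i (nc_i R).
have := step (- 'i) nNi.
have close (c : R[i]) : nc c = 1 -> (exists2 k, nc k < r &
    sqmod (G z) + eps * sqmod z < sqmod (G (z + k)) + eps * sqmod (z + k)) \/
   sqmod (G (z + c * s%:C)) + eps * sqmod (z + c * s%:C) <= sqmod (G z) + eps * sqmod z.
  move=> c1; have [?|h] := leP (sqmod (G (z + c * s%:C)) + eps * sqmod (z + c * s%:C)) (sqmod (G z) + eps * sqmod z); first by right.
  by left; exists (c * s%:C) => //; rewrite ncM c1 mul1r nc_real gtr0_norm.
have [//|] := close 1 (ComplexField.Normc.normc1 R).
have [//|] := close (-1) nN1.
have [//|] := close 'i (nc_i R).
have [//|] := close (- 'i) nNi.
move: es; move: (4 * nc (G z) * (e * s ^+ 2)) => E es.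
move: (sqmod (G (z + - 'i * _))) (sqmod (G (z + 'i * _))) (sqmod (G (z + -1 * _))) (sqmod (G (z + 1 * _))) => S1 S2 S3 S4.
move: (sqmod (G z)) (complex.Re (G z)) (complex.Im (G z)) => S0 g1 g2. rewrite /sqmod; case: z {HG Hd B0 e e0 Hr step close} => z1 z2.
case: al => a1 a2; case: d => d1 d2.
rewrite !expr2 /=. lra.
Qed.

End MaximumPrinciple.

(** * Rules of complex differentiation *)

Section ComplexDifferentiability.
Variable R : realType.
Notation nc := (@ComplexField.Normc.normc R).
Implicit Types (f g : R[i] -> R[i]) (z w k p : R[i]) (e r : R).

Lemma cdiff_at_cst (c : R[i]) z : cdiff_at (fun=> c) z.
Proof.
exists 0 => e e0; exists 1 => // k _.
by rewrite subrr mul0r subrr nc0 mulr_ge0 ?nc_ge0// ltW.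
Qed.

Lemma cdiff_atD f g z : cdiff_at f z -> cdiff_at g z -> cdiff_at (fun z => f z + g z) z.
Proof.
move=> [d Hd] [d' Hd']; exists (d + d') => e e0.
have e2 : 0 < e / 2 by rewrite divr_gt0.
have [r r0 Hr] := Hd _ e2; have [r' r'0 Hr'] := Hd' _ e2.
exists (Num.min r r'); first by rewrite lt_min r0.
move=> k; rewrite lt_min => /andP[/Hr h /Hr' h'].
rewrite [X in nc X](_ : _ = (f (z + k) - f z - d * k) + (g (z + k) - g z - d' * k)); last by ring.
by rewrite (le_trans (ncD _ _))//; lra.
Qed.

Lemma cdiff_atM f g z : cdiff_at f z -> cdiff_at g z -> cdiff_at (fun z => f z * g z) z.
Proof.
move=> [d Hd] [d' Hd']; exists (d * g z + f z * d') => e e0.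
have A0 := nc_ge0 (f z); have B0 := nc_ge0 (g z); have C0 := nc_ge0 d; have D0 := nc_ge0 d'.
set A := nc (f z) in A0 *; set B := nc (g z) in B0 *; set C := nc d in C0 *; set D := nc d' in D0 *.
pose e1 := Num.min 1 (e / (3 * (A + B + 1))).
have AB : 0 < 3 * (A + B + 1) by lra.
have e10 : 0 < e1 by rewrite lt_min ltr01 divr_gt0.
have e11 : e1 <= 1 by rewrite ge_min lexx.
have e12 : e1 * (3 * (A + B + 1)) <= e by rewrite -ler_pdivlMr// ge_min lexx orbT.
have [r r0 Hr] := Hd _ e10; have [r' r'0 Hr'] := Hd' _ e10.
have CD : 0 < 3 * ((C + 1) * (D + 1)) by rewrite !mulr_gt0//; lra.
exists (Num.min (Num.min r r') (e / (3 * ((C + 1) * (D + 1))))).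
  by rewrite !lt_min r0 r'0 divr_gt0.
move=> k; rewrite !lt_min ltr_pdivlMr// => /andP[/andP[/Hr h /Hr' h'] kr].
have k0 := nc_ge0 k; have ek : e1 * nc k <= nc k by rewrite ler_piMl.
have df : nc (f (z + k) - f z) <= (C + 1) * nc k.
  rewrite -(subrK (d * k) (f (z + k) - f z)) (le_trans (ncD _ _))// ncM -/C; lra.
have dg : nc (g (z + k) - g z) <= (D + 1) * nc k.
  rewrite -(subrK (d' * k) (g (z + k) - g z)) (le_trans (ncD _ _))// ncM -/D; lra.
rewrite [X in nc X](_ : _ = (f (z + k) - f z - d * k) * g z + f z * (g (z + k) - g z - d' * k)
  + (f (z + k) - f z) * (g (z + k) - g z)); last by ring.
rewrite (le_trans (ncD _ _))// (le_trans (lerD (ncD _ _) (lexx _)))// !ncM.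
have h3 : nc (f (z + k) - f z) * nc (g (z + k) - g z) <= (C + 1) * nc k * ((D + 1) * nc k).
  by rewrite ler_pM ?nc_ge0.
have h4 : (C + 1) * nc k * ((D + 1) * nc k) <= e / 3 * nc k.
  rewrite (_ : _ * _ = ((C + 1) * (D + 1) * nc k) * nc k); last by ring.
  by rewrite ler_wpM2r//; lra.
have h5 : nc (f (z + k) - f z - d * k) * B <= e1 * nc k * B by rewrite ler_wpM2r.
have h6 : A * nc (g (z + k) - g z - d' * k) <= A * (e1 * nc k) by rewrite ler_wpM2l.
have h7 : e1 * nc k * B + A * (e1 * nc k) <= e / 3 * nc k.
  rewrite (_ : _ + _ = (e1 * (A + B)) * nc k); last by ring.
  by rewrite ler_wpM2r//; lra.
have : 0 <= e * nc k by rewrite mulr_ge0// ltW.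
rewrite -/A -/B; lra.
Qed.

Lemma cdiff_atV p z : z != p -> cdiff_at (fun z => (z - p)^-1) z.
Proof.
rewrite -subr_eq0 => w0; set w := z - p in w0.
exists (- w ^- 2) => e e0.
have nw : 0 < nc w by rewrite nc_gt0.
exists (Num.min (nc w / 2) (e * nc w ^+ 3 / 2)).
  by rewrite lt_min !divr_gt0// mulr_gt0// exprn_gt0.
move=> k; rewrite lt_min => /andP[k1 k2].
have nwk : nc w / 2 <= nc (w + k).
  have : nc w <= nc (w + k) + nc k by rewrite -[in leLHS](addrK k w) ncB.
  lra.
have wk0 : w + k != 0 by rewrite -nc_gt0; apply: lt_le_trans nwk; rewrite divr_gt0.
rewrite [z + k - p]addrAC -/w.
rewrite [X in nc X](_ : _ = k ^+ 2 * (w ^+ 2 * (w + k))^-1); last by field; rewrite w0 wk0.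
rewrite ncM ncV ncM !ncX; have k0 := nc_ge0 k.
rewrite ler_pdivrMr; last by rewrite mulr_gt0 ?exprn_gt0// (lt_le_trans _ nwk)// divr_gt0.
rewrite expr2 [e * _]mulrC -mulrA ler_wpM2l//.
apply: le_trans (ltW k2) _.
rewrite (_ : e * _ / 2 = e * (nc w ^+ 2 * (nc w / 2))); last by field.
by rewrite ler_wpM2l ?(ltW e0)// ler_wpM2l// exprn_ge0// ltW.
Qed.

Lemma cdiff_affine_comp f w s : cdiff f -> cdiff (fun z => f (w + s * z)).
Proof.
move=> fd z; have [d Hd] := fd (w + s * z); exists (d * s) => e e0.
have S0 : 0 < nc s + 1 by rewrite ltr_wpDl ?nc_ge0.
have [r r0 Hr] := Hd (e / (nc s + 1)) (divr_gt0 e0 S0).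
exists (r / (nc s + 1)); first by rewrite divr_gt0.
move=> k; rewrite ltr_pdivlMr// => kr.
have k0 := nc_ge0 k; have s0 := nc_ge0 s.
have := Hr (s * k); rewrite ncM mulrA => H; rewrite mulrDr addrA.
rewrite (le_trans (H _))//; first by rewrite mulrC; lra.
rewrite mulrA ler_wpM2r// mulrAC ler_pdivrMr//; nra.
Qed.

Lemma cdiff_sum I (s : seq I) (F : I -> R[i] -> R[i]) :
  (forall i, cdiff (F i)) -> cdiff (fun z => \sum_(i <- s) F i z).
Proof.
move=> Fd z; elim: s => [|i s IH].
  suff -> : (fun z => \sum_(i <- [::]) F i z) = fun=> 0 by exact: cdiff_at_cst.
  by apply/funext => w; rewrite big_nil.
suff -> : (fun z => \sum_(j <- i :: s) F j z) = fun z => F i z + \sum_(j <- s) F j z.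
  exact: (cdiff_atD (Fd i z) IH).
by apply/funext => w; rewrite big_cons.
Qed.

(* The value at [p] is the junk value [0 / 0 = 0], which is the right one. *)
Lemma cdiff_sqr_div f p : cdiff f -> f p = 0 -> cdiff (fun z => f z ^+ 2 / (z - p)).
Proof.
move=> fd fp0 z; have [->{z}|zp] := eqVneq z p; last first.
  by apply: cdiff_atM; [apply: cdiff_atM; exact: fd|exact: cdiff_atV].
have [d Hd] := fd p; exists (d ^+ 2) => e e0.
have d0 := nc_ge0 d.
(* The remainder f(p + k)^2 / k - d^2 k factors as (f - d k)(f + d k) / k, hence is at most e1 (2
   |d| + 1) |k| as soon as e1 <= 1. *)
have e10 : 0 < Num.min 1 (e / (2 * nc d + 1)).
  by rewrite lt_min ltr01 divr_gt0// ltr_wpDl// mulr_ge0.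
have [r r0 Hr] := Hd _ e10; exists r => // k /Hr.
have : Num.min 1 (e / (2 * nc d + 1)) <= 1 by rewrite ge_min lexx.
have : Num.min 1 (e / (2 * nc d + 1)) * (2 * nc d + 1) <= e.
  by rewrite -ler_pdivlMr ?ge_min ?lexx ?orbT// ltr_wpDl// mulr_ge0.
move: e10; set e1 := Num.min _ _ => e10 he1 he2.
rewrite fp0 subr0 subrr expr0n /= mul0r subr0 [p + k]addrC addrK.
have [->|k0 H] := eqVneq k 0; first by rewrite add0r fp0 invr0 !mulr0 subrr nc0 !mulr0.
have kp : 0 < nc k by rewrite nc_gt0.
rewrite [X in nc X](_ : _ = (f (k + p) - d * k) * ((f (k + p) - d * k) + (d * k + d * k)) / k); last by field.
rewrite !ncM ncV ler_pdivrMr//.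
have ek : e1 * nc k <= nc k by rewrite ler_piMl// ltW.
have h2 : nc (f (k + p) - d * k + (d * k + d * k)) <= (2 * nc d + 1) * nc k.
  by rewrite (le_trans (ncD _ _))// (le_trans (lerD H (ncD _ _)))// ncM; lra.
rewrite (le_trans (ler_pM _ _ H h2)) ?nc_ge0//.
rewrite (_ : e1 * _ * _ = e1 * (2 * nc d + 1) * nc k * nc k); last by ring.
by rewrite !ler_pM2r.
Qed.

End ComplexDifferentiability.

(** * Compactness in the plane, the maximum principle and Schwarz's lemma *)

Section PlaneTopology.
Variable R : realType.
Notation nc := (@ComplexField.Normc.normc R).
Implicit Types (f G : R[i] -> R[i]) (K U : set R[i]) (z w k p : R[i]) (e r : R).

Lemma lip_comp_continuous f (g : R[i] -> R) : ccont f ->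
  (forall z w, `|g z - g w| <= nc (z - w)) -> continuous ((fun z => g (f z)) : R[i]^o -> R).
Proof.
move=> fc gl z A /nbhs_ballP[e /= e0 HA]; apply/cnbhsP.
have [r r0 H] := fc z (e / 2) (divr_gt0 e0 (ltr0Sn R 1)); exists r => // w /H /=.
rewrite [z + _]addrC subrK => h; apply: HA.
by rewrite /ball /= distrC (le_lt_trans (gl _ _))//; lra.
Qed.

Lemma ccont_id : ccont (@id R[i]).
Proof. by move=> z e e0; exists e => // k /ltW; rewrite [z + k]addrC addrK. Qed.

Lemma sqmod_comp_continuous f : ccont f -> continuous ((fun z => sqmod (f z)) : R[i]^o -> R).
Proof.
move=> fc z.
have h1 := lip_comp_continuous fc (@norm_ReB R) (x := z).
have h2 := lip_comp_continuous fc (@norm_ImB R) (x := z).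
rewrite /sqmod.
apply: (@cvgD R R R[i]^o (nbhs z)); [exact: (cvgM h1 h1)|exact: (cvgM h2 h2)].
Qed.

Lemma norm_ncB z w : `|nc z - nc w| <= nc (z - w).
Proof.
have h1 := ncD (z - w) w; have h2 := ncD (w - z) z.
move: h1 h2; rewrite !subrK -(opprB z w) ncN => h1 h2; rewrite ler_norml; lra.
Qed.

Lemma compact_box (B : R) : compact ([set z | `|complex.Re z| <= B /\ `|complex.Im z| <= B] : set R[i]^o).
Proof.
have -> : [set z | `|complex.Re z| <= B /\ `|complex.Im z| <= B] =
    (fun q : R * R => q.1 +i* q.2) @` (`[- B, B] `*` `[- B, B]).
  apply/seteqP; split => [[x y] /= [hx hy]|_ [[x y] /= [hx hy] <-]] /=.
    by exists (x, y) => //=; rewrite !in_itv /= -!ler_norml.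
  by move: hx hy; rewrite !in_itv /= -!ler_norml.
apply: (@continuous_compact _ R[i]^o); last by apply: compact_setX; exact: segment_compact.
apply: continuous_subspaceT => -[x y] A /cnbhsP[r r0 H].
exists (ball x (r / 2), ball y (r / 2)); first by split; apply: nbhsx_ballx; rewrite divr_gt0.
move=> [x' y'] /= [hx hy]; apply: H; rewrite (le_lt_trans (nc_ReIm _))//=.
by rewrite /ball /= distrC in hx; rewrite /ball /= distrC in hy; lra.
Qed.

Lemma bounded_closed_compactC K (B : R) : closed (K : set R[i]^o) ->
  (forall z, K z -> nc z <= B) -> compact (K : set R[i]^o).
Proof.
move=> Kcl KB; apply: (@subclosed_compact R[i]^o K _ Kcl (@compact_box B)) => z Kz.
by split; rewrite (le_trans _ (KB _ Kz))// ?nc_Re ?nc_Im.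
Qed.

Lemma compact_disc p r : compact ([set z | nc (z - p) <= r] : set R[i]^o).
Proof.
apply: (@bounded_closed_compactC _ (r + nc p)); last first.
  by move=> z /= zr; rewrite -[z](subrK p) (le_trans (ncD _ _))// lerD2r.
have gc : continuous ((fun z => nc (z - p)) : R[i]^o -> R).
  apply: (@lip_comp_continuous id (fun z => nc (z - p)) ccont_id) => z w.
  by rewrite (le_trans (norm_ncB _ _))// opprB addrA subrK.
apply: (@preimage_closed R[i]^o R (fun z => nc (z - p)) [set t | t <= r]); last exact: closed_le.
by move=> z _; exact: gc.
Qed.

Lemma open_disc p r : open ([set z | nc (z - p) < r] : set R[i]^o).
Proof.
rewrite openE => z zr; apply/cnbhsP; exists (r - nc (z - p)); first by rewrite subr_gt0.
move=> w wz /=; rewrite -[w](subrK z) -addrA (le_lt_trans (ncD _ _))//; lra.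
Qed.

(** Only [z] is confined to [K]: the increment may leave it, as happens in a neighbourhood of the
    curve. *)
Lemma heine_cantor K f (eta : R) : compact (K : set R[i]^o) -> ccont f -> 0 < eta ->
  exists2 del, 0 < del & forall z k, K z -> nc k <= del -> nc (f (z + k) - f z) <= eta.
Proof.
move=> /compact_near_coveringP Kc fc eta0.
pose P (d : R) (z : R[i]^o) := forall k, nc k <= d -> nc (f (z + k) - f z) <= eta.
have /= : \forall d \near 0^'+, (K : set R[i]^o) `<=` P d.
  apply: Kc => z Kz; have [r r0 H] := fc z (eta / 2) (divr_gt0 eta0 (ltr0Sn R 1)).
  have r2 : 0 < r / 2 by rewrite divr_gt0.
  exists ([set w | nc (w - z) < r / 2], [set d | d < r / 2]).
    split => /=; last exact: nbhs_right_lt.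
    by apply/cnbhsP; exists (r / 2).
  move=> [w d] /= [wz dr] k kd.
  have h1 := H (w - z); have h2 := H (w - z + k).
  rewrite addrA [z + _]addrC subrK in h2; rewrite [z + _]addrC subrK in h1.
  have {}h1 : nc (f w - f z) <= eta / 2 by apply: h1; lra.
  have {}h2 : nc (f (w + k) - f z) <= eta / 2.
    by apply: h2; rewrite (le_lt_trans (ncD _ _))//; lra.
  rewrite (_ : f (w + k) - f w = (f (w + k) - f z) - (f w - f z)); last by ring.
  by rewrite (le_trans (ncB _ _))//; lra.
move=> H; near (0:R)^'+ => d; exists d; first by near: d; exact: nbhs_right_gt.
move=> z k Kz kd; have : (K : set R[i]^o) `<=` P d by near: d.
by move=> /(_ _ Kz); apply.
Unshelve. all: by end_near. Qed.

Lemma taylor2_ccont G : taylor2 G -> ccont G.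
Proof.
move=> HG z e e0; have [al [d Hd]] := HG z; have [r r0 Hr] := Hd 1 ltr01.
have a0 := nc_ge0 al; have d0 := nc_ge0 d.
have C0 : 0 < 1 + nc al + nc d by lra.
exists (Num.min (Num.min r 1) (e / (1 + nc al + nc d))).
  by rewrite !lt_min r0 ltr01 divr_gt0.
move=> k; rewrite !lt_min ltr_pdivlMr// => /andP[/andP[/Hr h k1] ke].
have k0 := nc_ge0 k.
have k2 : nc k ^+ 2 <= nc k by rewrite expr2 ler_piMl// ltW.
rewrite (_ : G (z + k) - G z = (G (z + k) - G z - al * k - d * k ^+ 2) + al * k + d * k ^+ 2); last by ring.
rewrite (le_trans (ncD _ _))// (le_trans (lerD (ncD _ _) (lexx _)))// [nc (al * _)]ncM [nc (d * _)]ncM ncX.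
have : nc d * nc k ^+ 2 <= nc d * nc k by rewrite ler_wpM2l.
lra.
Qed.

(** A maximum on [K] of |G|^2 + eps |z|^2 cannot lie in the open set [U], so it lies where |G| <= M.
    The perturbation costs at most eps |b|^2, with [b] a point of [K] of largest modulus, and eps
    tends to 0. *)
Lemma max_principle_taylor2 G K U (M : R) :
  compact (K : set R[i]^o) -> open (U : set R[i]^o) -> U `<=` K -> taylor2 G ->
  (forall z, K z -> ~ U z -> nc (G z) <= M) -> forall z, K z -> nc (G z) <= M.
Proof.
move=> Kc Uo UK HG HM z Kz.
have K0 : (K : set R[i]^o) !=set0 by exists z.
have cG := sqmod_comp_continuous (taylor2_ccont HG).
have cI := sqmod_comp_continuous ccont_id.
have [b Kb Hb] := compact_EVT_max K0 Kc (continuous_subspaceT cI).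
have key eps : 0 < eps -> exists2 c, K c /\ ~ U c & sqmod (G z) <= sqmod (G c) + eps * sqmod b.
  move=> eps0.
  pose g (w : R[i]^o) : R := sqmod (G w) + eps * sqmod w.
  have cg : continuous g.
    move=> w; have h1 := cG w; have h2 := cI w.
    by apply: (@cvgD R R R[i]^o (nbhs w)); [exact: h1|exact: (cvgM (cvg_cst eps) h2)].
  have [c Kc' Hc] := compact_EVT_max K0 Kc (continuous_subspaceT cg).
  rewrite inE in Kc'; exists c.
    split=> // Uc; have /cnbhsP[r r0 Hr] : nbhs (c : R[i]^o) U by exact: open_nbhs_nbhs.
    have [k kr] := taylor2_no_local_max c HG eps0 r0.
    apply/negP; rewrite -leNgt; apply: Hc; rewrite inE; apply/UK/Hr.
    by rewrite [c + k]addrC addrK.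
  have := Hc z; rewrite inE => /(_ Kz); rewrite /g => h.
  have hb : sqmod c <= sqmod b by apply: Hb; rewrite inE.
  have hz : 0 <= sqmod z by rewrite -nc_sq exprn_ge0// nc_ge0.
  have := ler_wpM2l (ltW eps0) hb; have := mulr_ge0 (ltW eps0) hz; lra.
have M0 : 0 <= M.
  by have [c [Kc' /(HM c Kc') h] _] := key 1 ltr01; exact: le_trans (nc_ge0 _) h.
rewrite -ler_sqr ?nnegrE ?nc_ge0// nc_sq; apply/ler_addgt0Pr => e e0.
have b0 : 0 <= sqmod b by rewrite -nc_sq exprn_ge0// nc_ge0.
have [|c [Kc' Uc] h] := key (e / (sqmod b + 1)); first by rewrite divr_gt0// ltr_wpDl.
apply: (le_trans h); apply: lerD.
  by rewrite -nc_sq ler_sqr ?nnegrE ?nc_ge0// HM.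
by rewrite mulrAC ler_pdivrMr ?ltr_wpDl// ler_wpM2l ?lerDl// ltW.
Qed.

(* [f] is a uniform limit of difference quotients of its primitive, which have
   second-order expansions. *)
Lemma max_principle f K U (M : R) :
  compact (K : set R[i]^o) -> open (U : set R[i]^o) -> U `<=` K -> cdiff f ->
  (forall z, K z -> ~ U z -> nc (f z) <= M) -> forall z, K z -> nc (f z) <= M.
Proof.
move=> Kc Uo UK fd HM z Kz; apply/ler_addgt0Pr => e e0.
(* With oscillation e / 8, [primitive_diff_le] puts [G] within e / 2 of [f] on [K]. This is spent
   twice, off [U] and at [z]. That lemma looks at increments up to [2 * nc h], hence the step
   [del / 2]. *)
have [del del0 Hdel] := heine_cantor Kc (cdiff_ccont fd) (divr_gt0 e0 (ltr0Sn R 7)).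
pose h : R[i] := (del / 2)%:C.
have nh : nc h = del / 2 by rewrite nc_real ger0_norm// divr_ge0// ltW.
have nh0 : 0 < nc h by rewrite nh divr_gt0.
have h0 : h != 0 by rewrite -nc_gt0.
clearbody h.
pose G w := (primitive f (w + h) - primitive f w) / h.
have Gf w : K w -> nc (G w - f w) <= e / 2.
  move=> Kw; have H1 : forall k, nc k <= 2 * nc h -> nc (f (w + k) - f w) <= e / 8.
    by move=> k; rewrite nh => kd; apply: Hdel => //; lra.
  have := primitive_diff_le fd H1.
  rewrite (_ : _ - _ - _ = (G w - f w) * h); last by rewrite /G; field.
  by rewrite ncM ler_pM2r//; lra.
have GT : taylor2 G.
  move=> w; have [al [d Hd]] := primitive_taylor2 fd w.
  have [al' [d' Hd']] := primitive_taylor2 fd (w + h).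
  exists ((al' - al) / h), ((d' - d) / h) => e1 e10.
  have e1h : 0 < e1 * nc h / 2 by rewrite divr_gt0// mulr_gt0.
  have [r r0 Hr] := Hd _ e1h; have [r' r'0 Hr'] := Hd' _ e1h.
  exists (Num.min r r'); first by rewrite lt_min r0.
  move=> k; rewrite lt_min => /andP[/Hr H1 /Hr' H2].
  rewrite (_ : _ - _ - _ - _ = ((primitive f (w + h + k) - primitive f (w + h) - al' * k - d' * k ^+ 2) -
     (primitive f (w + k) - primitive f w - al * k - d * k ^+ 2)) / h); last first.
    by rewrite /G [w + k + h]addrAC; field.
  rewrite ncM ncV ler_pdivrMr// (le_trans (ncB _ _))//.
  have -> : e1 * nc k ^+ 2 * nc h = e1 * nc h / 2 * nc k ^+ 2 + e1 * nc h / 2 * nc k ^+ 2 by field.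
  exact: lerD.
have HG : nc (G z) <= M + e / 2.
  apply: (max_principle_taylor2 Kc Uo UK GT _ Kz) => w Kw Uw.
  rewrite -[G w](subrK (f w)) (le_trans (ncD _ _))//.
  by have := Gf w Kw; have := HM w Kw Uw; lra.
have := Gf z Kz; rewrite -ncN opprB => h1.
by rewrite -[f z](subrK (G z)) (le_trans (ncD _ _))//; lra.
Qed.

(** The maximum principle on the disc for [f z ^+ 2 / (z - p)], whose modulus is at most M^2 / r on
    the circle. *)
Lemma schwarz_sqrt f p r (M : R) : cdiff f -> f p = 0 -> 0 < r ->
  (forall z, nc (z - p) <= r -> nc (f z) <= M) ->
  forall z, nc (z - p) <= r -> sqmod (f z) <= M ^+ 2 * nc (z - p) / r.
Proof.
move=> fd fp0 r0 HM z zr.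
have H w : nc (w - p) <= r -> nc (f w ^+ 2 / (w - p)) <= M ^+ 2 / r.
  apply: (max_principle (compact_disc (p := p) (r := r)) (open_disc (p := p) (r := r)) _ (cdiff_sqr_div fd fp0)).
    by move=> v /= /ltW.
  move=> v /= vr /negP; rewrite -leNgt => rv.
  have -> : nc (f v ^+ 2 / (v - p)) = nc (f v) ^+ 2 / r.
    by rewrite ncM ncV ncX; congr (_ / _); apply/eqP; rewrite eq_le vr.
  rewrite ler_pM2r ?invr_gt0// ler_sqr ?nnegrE ?nc_ge0 ?HM//.
  by rewrite (le_trans (nc_ge0 (f v))) ?HM.
have := H z zr; rewrite -nc_sq.
have [->|zp] := eqVneq z p; first by move=> _; rewrite fp0 subrr nc0 expr0n /= mulr0 mul0r.
have nzp : 0 < nc (z - p) by rewrite nc_gt0 subr_eq0.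
by rewrite ncM ncV ncX ler_pdivrMr// mulrAC.
Qed.

End PlaneTopology.

(** * The inside of a curve *)

Section Inside.
Variable R : realType.
Notation nc := (@ComplexField.Normc.normc R).
Implicit Types (f : R[i] -> R[i]) (Gamma K : set R[i]) (z w k p v : R[i]) (e r : R).

Lemma compact_nc_max f K : compact (K : set R[i]^o) -> ccont f -> (exists z, K z) ->
  exists2 c, K c & forall z, K z -> nc (f z) <= nc (f c).
Proof.
move=> Kc fc K0.
have cf : continuous ((fun z => nc (f z)) : R[i]^o -> R).
  exact: (@lip_comp_continuous R f nc fc (@norm_ncB R)).
have [c] := @compact_EVT_max R[i]^o R _ K K0 Kc (continuous_subspaceT cf).
rewrite inE => Kc' H; exists c => // z Kz; apply: H; rewrite inE.
exact: Kz.
Qed.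

Lemma compact_nc_bounded K : compact (K : set R[i]^o) -> exists B : R, forall z, K z -> nc z <= B.
Proof.
move=> Kc; have [K0|K0] := pselect (exists z, K z).
  by have [c _ Hc] := compact_nc_max Kc (@ccont_id R) K0; exists (nc c).
by exists 0 => z Kz; case: K0; exists z.
Qed.

Lemma segment_connected_component (A : set R[i]^o) w r v :
  (forall u, nc (u - w) < r -> A u) -> nc (v - w) < r ->
  connected_component A w v.
Proof.
move=> HA vr.
pose g (t : R) : R[i]^o := w + t%:C * (v - w).
have gc : continuous g.
  move=> t B /cnbhsP[e e0 HB].
  have C0 : 0 < 1 + nc (v - w) by rewrite ltr_wpDr ?nc_ge0.
  apply/nbhs_ballP; exists (e / (1 + nc (v - w))); first by rewrite /= divr_gt0.
  move=> s; rewrite /ball /= ltr_pdivlMr// => st; apply: HB.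
  rewrite (_ : g s - g t = (s - t)%:C * (v - w)); last by rewrite /g rmorphB /=; ring.
  rewrite ncM nc_real distrC; apply: le_lt_trans st.
  by rewrite ler_wpM2l// lerDr.
exists (g @` `[0, 1]); last first.
  by exists 1; rewrite /= ?in_itv /= ?ler01 ?lexx// /g mul1r addrC subrK.
split.
- by exists 0; rewrite /= ?in_itv /= ?ler01 ?lexx// /g mul0r addr0.
- move=> _ [t /= + <-]; rewrite in_itv /= => /andP[t0 t1]; apply: HA.
  rewrite /g [w + _]addrC addrK ncM nc_real ger0_norm//.
  by apply: le_lt_trans vr; rewrite ler_piMl// nc_ge0.
- apply: connected_continuous_connected; last exact: continuous_subspaceT.
  by apply/connected_intervalP; exact: interval_is_interval.
Qed.

Lemma closedC_ball Gamma z : closed (Gamma : set R[i]^o) -> ~ Gamma z ->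
  exists2 r, 0 < r & forall u, nc (u - z) < r -> ~ Gamma u.
Proof.
move=> /closed_openC Go Gz.
have /cnbhsP[r r0 Hr] : nbhs (z : R[i]^o) (~` Gamma) by exact: open_nbhs_nbhs.
by exists r.
Qed.

Lemma component_ball Gamma z w : closed (Gamma : set R[i]^o) ->
  connected_component (~` Gamma : set R[i]^o) z w ->
  exists2 r, 0 < r & forall v, nc (v - w) < r ->
    connected_component (~` Gamma : set R[i]^o) z v.
Proof.
move=> Gc Czw; have [r r0 Hr] := closedC_ball Gc (connected_component_sub Czw).
exists r => // v vw; apply: (connected_component_trans Czw).
exact: (segment_connected_component Hr).
Qed.

Lemma inside_open Gamma : closed (Gamma : set R[i]^o) -> open (inside Gamma : set R[i]^o).
Proof.
move=> Gc; rewrite openE => z [Gz bz]; apply/cnbhsP.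
have [r r0 Hr] := component_ball Gc (connected_component_refl (A := ~` Gamma : set R[i]^o) Gz).
exists r => // w wz; have Czw := Hr w wz; split; first exact: (connected_component_sub Czw).
by rewrite -(same_connected_component Czw).
Qed.

(** The component [C] of [z] is open and its boundary lies in [Gamma], so [C] together with [Gamma]
    is compact and the maximum principle applies. *)
Lemma inside_le f Gamma (B M : R) : cdiff f -> closed (Gamma : set R[i]^o) ->
  (forall w, Gamma w -> nc w <= B) -> (forall w, Gamma w -> nc (f w) <= M) ->
  forall z, inside Gamma z -> nc (f z) <= M.
Proof.
move=> fd Gc GB GM z [Gz bz].
set C := connected_component (~` Gamma : set R[i]^o) z in bz.
have Co : open (C : set R[i]^o).
  rewrite openE => w Cw; apply/cnbhsP; have [r r0 Hr] := component_ball Gc Cw.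
  by exists r.
have [b b0 Hb] := ex_strict_bound_gt0 bz.
(* A point off both sets has a disc around it inside its own component, which is disjoint from
   [C]. *)
have Kcl : closed (C `|` Gamma : set R[i]^o).
  rewrite -[_ `|` _]setCK; apply: open_closedC; rewrite openE => w; rewrite setCU => -[Cw Gw].
  apply/cnbhsP; have [r r0 Hr] := component_ball Gc (connected_component_refl (A := ~` Gamma : set R[i]^o) Gw).
  exists r => // v /Hr Cwv; split; last exact: (connected_component_sub Cwv).
  move=> Cv; apply: Cw; apply: (connected_component_trans Cv).
  exact: connected_component_sym.
have Kc : compact (C `|` Gamma : set R[i]^o).
  apply: (@bounded_closed_compactC R _ (complex.Re b + `|B|) Kcl) => w [Cw|/GB h]; last first.
    rewrite (le_trans h)// (le_trans (ler_norm B))// lerDr.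
    by move: b0; rewrite ltcE => /andP[_ /ltW].
  have := Hb w Cw; rewrite /= norm_nc ltcE /= => /andP[_ /ltW h].
  by rewrite (le_trans h)// lerDl.
apply: (max_principle Kc Co _ fd).
- by move=> w Cw; left.
- by move=> w [//|Gw] _; exact: GM.
- by left; exact: connected_component_refl.
Qed.

Lemma compact_ball_sub K (U : set R[i]) : compact (K : set R[i]^o) -> open (U : set R[i]^o) ->
  K `<=` U -> exists2 r, 0 < r & forall z v, K z -> nc (v - z) <= r -> U v.
Proof.
move=> /compact_near_coveringP Kc Uo KU.
pose P (d : R) (z : R[i]^o) := forall v, nc (v - z) <= d -> U v.
have /= : \forall d \near 0^'+, (K : set R[i]^o) `<=` P d.
  apply: Kc => z Kz.
  have /cnbhsP[r r0 H] : nbhs (z : R[i]^o) U by apply: open_nbhs_nbhs; split => //; exact: KU.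
  have r2 : 0 < r / 2 by rewrite divr_gt0.
  exists ([set w | nc (w - z) < r / 2], [set d | d < r / 2]).
    split => /=; last exact: nbhs_right_lt.
    by apply/cnbhsP; exists (r / 2).
  move=> [w d] /= [wz dr] v vw; apply: H.
  by rewrite -[v](subrK w) -addrA (le_lt_trans (ncD _ _))//; lra.
move=> H; near (0:R)^'+ => d; exists d; first by near: d; exact: nbhs_right_gt.
move=> z v Kz vd; have : (K : set R[i]^o) `<=` P d by near: d.
by move=> /(_ _ Kz); apply.
Unshelve. all: by end_near. Qed.

Lemma compact_net K r : compact (K : set R[i]^o) -> 0 < r ->
  exists s : seq R[i], (forall p, p \in s -> K p) /\
    forall z, K z -> exists2 p, p \in s & nc (z - p) < r.
Proof.
rewrite compact_cover => Kc r0.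
have [||s sK Ks] := Kc R[i] K (fun p => [set z | nc (z - p) < r]).
- by move=> p _; exact: open_disc.
- by move=> z Kz; exists z => //=; rewrite subrr nc0.
exists (finmap.enum_fset s); split=> [p ps|z /Ks[p /= ps zp]]; last by exists p.
by have := sK p ps; rewrite inE.
Qed.

(* Equicontinuity: a bound on [Gamma] propagates inside by the maximum
   principle, and then Schwarz's lemma makes [f] small near its zeros. *)
Lemma small_inside Gamma K e : compact (Gamma : set R[i]^o) ->
  compact (K : set R[i]^o) -> K `<=` inside Gamma -> 0 < e ->
  exists s : seq R[i], forall f, cdiff f -> (forall p, p \in s -> f p = 0) ->
    forall M, (forall w, Gamma w -> nc (f w) <= M) ->
    forall z, K z -> sqmod (f z) <= e * M ^+ 2.
Proof.
move=> Gcpt Kc KG e0.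
have Gc : closed (Gamma : set R[i]^o) by apply: compact_closed => //; exact: norm_hausdorff.
have [B GB] := compact_nc_bounded Gcpt.
have [r r0 Hr] := compact_ball_sub Kc (inside_open Gc) KG.
(* Mesh [r] puts [z] in the disc of Schwarz's lemma; mesh [e * r] makes the factor [nc (z - p) / r]
   at most [e]. *)
have re : 0 < Num.min r (e * r) by rewrite lt_min r0 mulr_gt0.
have [s [sK Hs]] := compact_net Kc re.
exists s => f fd fs M fM z Kz.
have [p ps zp] := Hs z Kz.
move: zp; rewrite lt_min => /andP[zpr zpe].
have h := schwarz_sqrt fd (fs p ps) r0.
have {}h := h M _ z (ltW zpr); rewrite (le_trans (h _))//.
  by move=> v vp; apply: (inside_le fd Gc GB fM); exact: (Hr p v (sK p ps)).
rewrite ler_pdivrMr// (_ : e * M ^+ 2 * r = M ^+ 2 * (e * r)); last by ring.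
by rewrite ler_wpM2l ?sqr_ge0// ltW.
Qed.

Lemma smooth_closed_simple_curve_compact Gamma :
  smooth_closed_simple_curve Gamma -> compact (Gamma : set R[i]^o) /\ exists w, Gamma w.
Proof.
move=> [c [cd _ cper _ ->]]; split; last by exists (c 0), 0.
have -> : range c = c @` `[0, 1].
  apply/seteqP; split => [_ [t _ <-]|_ [t _ <-]]; last by exists t.
  have cn n s : c (s + n%:R) = c s.
    by elim: n => [|n IH]; rewrite ?addr0// -natr1 addrA cper.
  have cz (n : int) s : c (s + n%:~R) = c s.
    case: n => n; first exact: cn.
    by rewrite -(cn n.+1 (s + _)) NegzE mulrNz -addrA addNr addr0.
  exists (t - (Num.floor t)%:~R); last by rewrite -mulrNz cz.
  rewrite /= in_itv /= subr_ge0 ge_floor /= lerBlDl.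
  by have := floorD1_gt t; rewrite intrD1 => /ltW.
apply: (@continuous_compact _ R[i]^o); last exact: segment_compact.
apply: continuous_subspaceT => t A /cnbhsP[r r0 HA].
have /= [h1 h2] := cd 0%N t.
have c1 : {for t, continuous (fun s => complex.Re (c s))}.
  exact: (differentiable_continuous ((derivable1_diffP _ _).1 h1)).
have c2 : {for t, continuous (fun s => complex.Im (c s))}.
  exact: (differentiable_continuous ((derivable1_diffP _ _).1 h2)).
have r2 : 0 < r / 2 by rewrite divr_gt0.
move/cvgrPdist_lt : c1 => /(_ _ r2) c1.
move/cvgrPdist_lt : c2 => /(_ _ r2) c2.
suff : \forall s \near t, A (c s) by [].
near=> s; apply: HA; rewrite (le_lt_trans (nc_ReIm _))// !raddfB /=.
rewrite (splitr r) ltrD// distrC; first by near: s.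
by near: s.
Unshelve. all: by end_near. Qed.

End Inside.

(** * The mean value inequality *)

Section PlaneMeasure.
Variable R : realType.
Notation nc := (@ComplexField.Normc.normc R).
Notation mu2 := (@lebesgue2 R).
Notation T2 := (measurableTypeR R * measurableTypeR R)%type.
Implicit Types (f : R[i] -> R[i]) (z w k : R[i]) (e r x y : R).

Definition square x y r : set T2 := [set` `[x, x + r[%R] `*` [set` `[y, y + r[%R].

Lemma measurable_square x y r : measurable (square x y r).
Proof. by apply: measurableX. Qed.

Lemma lebesgue2_square x y r : 0 <= r -> mu2 (square x y r) = (r ^+ 2)%:E.
Proof.
move=> r0; rewrite /lebesgue2 /square product_measure1E//.
have E (t : R) : @lebesgue_measure R `[t, t + r[%classic = r%:E.
  rewrite lebesgue_measure_itv /= lte_fin ltrDl; have [r_gt0|rle0] := ltP 0 r.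
    by rewrite -EFinB addrAC subrr add0r.
  by congr EFin; apply/eqP; rewrite eq_le r0.
transitivity (r%:E * r%:E)%E; first by congr (_ * _)%E; exact: E.
by rewrite -EFinM expr2.
Qed.

(** [A] is the union of the boxes with rational data that it contains; the other boxes are replaced
    by [set0], so that the index type stays countable. *)
Lemma open_box_measurable (A : set T2) :
  (forall p : R * R, A p -> exists2 r, 0 < r & forall q : R * R,
     `|q.1 - p.1| < r -> `|q.2 - p.2| < r -> A q) -> measurable A.
Proof.
move=> HA.
pose box (u : rat * rat * rat) : set T2 :=
  [set` `]ratr u.1.1 - ratr u.2, ratr u.1.1 + ratr u.2[%R] `*`
  [set` `]ratr u.1.2 - ratr u.2, ratr u.1.2 + ratr u.2[%R].
pose F u : set T2 := if `[< box u `<=` A >] then box u else set0.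
have -> : A = \bigcup_u F u.
  apply/seteqP; split => [[p1 p2] Ap|p [u _]]; last first.
    by rewrite /F; case: asboolP => // + up; apply.
  have [r r0 Hr] := HA _ Ap; rewrite /= in Hr.
  (* A centre within r / 4 of the point and a half-side between r / 4 and r / 2 give a box that
     contains the point and stays within 3 r / 4 of it. *)
  have r4 : r / 4 < r / 2 by lra.
  have [c] := rat_in_itvoo r4; rewrite in_itv /= => /andP[c1 c2].
  have h1 : p1 - r / 4 < p1 + r / 4 by lra.
  have h2 : p2 - r / 4 < p2 + r / 4 by lra.
  have [a] := rat_in_itvoo h1; rewrite in_itv /= => /andP[a1 a2].
  have [b] := rat_in_itvoo h2; rewrite in_itv /= => /andP[b1 b2].
  exists (a, b, c) => //; rewrite /F asboolT.
    by split; rewrite /= in_itv /=; apply/andP; split; lra.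
  move=> [q1 q2] [/=]; rewrite !in_itv /= => /andP[? ?] /andP[? ?].
  by apply: Hr => /=; rewrite ltr_norml; apply/andP; split; lra.
apply: countable_bigcupT_measurable; first exact: countableP.
by move=> u; rewrite /F; case: ifP => // _; apply: measurableX.
Qed.

Lemma continuous_measurable_plane (g : R[i] -> R) : continuous (g : R[i]^o -> R) ->
  measurable_fun [set: T2] (fun p : T2 => g (p.1 +i* p.2)).
Proof.
move=> gc mD; apply: (measurability _ (RGenOInfty.measurableE R)) => //.
move=> _ [_ [x ->] <-]; rewrite setTI; apply: open_box_measurable => -[p1 p2] /=.
rewrite in_itv /= andbT => xg.
have : nbhs (g (p1 +i* p2)) [set t | x < t] by exact: lt_nbhsr.
move=> /(gc (p1 +i* p2)) /cnbhsP[r r0 Hr].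
exists (r / 2); first by rewrite divr_gt0.
move=> [q1 q2] /= h1 h2; rewrite in_itv /= andbT; apply: Hr.
by rewrite (le_lt_trans (nc_ReIm _))//= ; lra.
Qed.

Lemma measurable_sqmod_comp f : cdiff f ->
  measurable_fun [set: T2] (fun p : T2 => sqmod (f (p.1 +i* p.2))).
Proof.
move=> fd; exact: (continuous_measurable_plane (sqmod_comp_continuous (cdiff_ccont fd))).
Qed.

(** * Averages over a rotated grid *)

Section SubMean.
Variables (f : R[i] -> R[i]) (w : R[i]) (r eta del : R) (n : nat).
Hypotheses (fd : cdiff f) (r0 : 0 < r) (eta0 : 0 < eta) (n0 : (0 < n)%N).
Hypothesis unif : forall z k, nc (z - w) <= 2 * r -> nc k <= del ->
  nc (f (z + k) ^+ 2 - f z ^+ 2) <= eta.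
(** The grid has step 2 h and coordinates at most 2 h (n - 1), so its points have modulus at most r
    - 4 h: a cell of side [h] at a rotated point still fits in [D]. *)
Let h : R := r / (4 * n%:R).
Hypothesis hdel : 2 * h <= del.

Let N0 : 0 < n%:R :> R. Proof. by rewrite ltr0n. Qed.
Let h0 : 0 < h. Proof. by rewrite divr_gt0// mulr_gt0. Qed.
Let hr : r = 4 * n%:R * h. Proof. by rewrite /h; field; rewrite gt_eqF. Qed.

Let grid (q : 'I_n * 'I_n) : R[i] := (2 * h * q.1%:R) +i* (2 * h * q.2%:R).
Let D : set T2 := square (complex.Re w - r) (complex.Im w - r) (2 * r).

Let grid_le q : nc (grid q) <= r - 4 * h.
Proof.
rewrite (le_trans (nc_ReIm _))//= !ger0_norm ?(mulr_ge0 _ (ler0n _ _)) ?mulr_ge0 ?(ltW h0) ?(ltW r0)//.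
have l1 : q.1%:R + 1 <= n%:R :> R by rewrite natr1 ler_nat.
have l2 : q.2%:R + 1 <= n%:R :> R by rewrite natr1 ler_nat.
have h2 : 0 <= 2 * h by have := h0; lra.
have := ler_wpM2l h2 l1; have := ler_wpM2l h2 l2; have := hr.
by move: h => hh; lra.
Qed.

(** Only the corner turns with [zeta]; the cell stays parallel to the axes and so remains a product
    of intervals. *)
Let cell (zeta : R[i]) q : set T2 :=
  square (complex.Re (w + grid q * zeta)) (complex.Im (w + grid q * zeta)) h.

Let cell_sub zeta q : nc zeta = 1 -> cell zeta q `<=` D.
Proof.
move=> z1 [x y] [/=]; rewrite !in_itv /= => /andP[x1 x2] /andP[y1 y2].
have := nc_Re (grid q * zeta); have := nc_Im (grid q * zeta).
rewrite ncM z1 mulr1 => /le_trans/(_ (grid_le q)) + /le_trans/(_ (grid_le q)).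
move: x1 x2 y1 y2; rewrite !raddfD /= !ler_norml => ? ? ? ? /andP[? ?] /andP[? ?].
by have := h0; move: h => hh ?; split; rewrite /= in_itv /=; apply/andP; split; lra.
Qed.

(* The rotated grid points are [2 h] apart, more than the diagonal of a cell. *)
Let cell_disj zeta : nc zeta = 1 -> trivIset setT (cell zeta).
Proof.
move=> z1; apply/trivIsetP => q q' _ _ qq'.
apply/eqP/negPn/negP => /set0P [[x y] [[/=]]]; rewrite !in_itv /= => /andP[x1 x2] /andP[y1 y2].
move=> [/=]; rewrite !in_itv /= => /andP[x1' x2'] /andP[y1' y2'].
set u := grid q * zeta in x1 x2 y1 y2 *; set u' := grid q' * zeta in x1' x2' y1' y2' *.
have Hx : `|complex.Re (u - u')| < h.
  by rewrite ltr_norml raddfB /=; move: x1 x2 x1' x2'; rewrite !raddfD /= => *; apply/andP; split; lra.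
have Hy : `|complex.Im (u - u')| < h.
  by rewrite ltr_norml raddfB /=; move: y1 y2 y1' y2'; rewrite !raddfD /= => *; apply/andP; split; lra.
have : sqmod (u - u') < 4 * h ^+ 2.
  rewrite /sqmod -(real_normK (num_real (complex.Re _))) -(real_normK (num_real (complex.Im _))).
  have := normr_ge0 (complex.Re (u - u')); have := normr_ge0 (complex.Im (u - u')); nra.
apply/negP; rewrite -leNgt -nc_sq -mulrBl ncM z1 mulr1 nc_sq /sqmod !raddfB /=.
rewrite [leRHS](_ : _ = 4 * h ^+ 2 *
  ((q.1%:R - q'.1%:R) ^+ 2 + (q.2%:R - q'.2%:R) ^+ 2)); last by move: h => hh; ring.
have h4 : 0 <= 4 * h ^+ 2 by rewrite mulr_ge0// sqr_ge0.
rewrite ler_peMr//.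
have far (a b : 'I_n) : a != b -> 1 <= (a%:R - b%:R : R) ^+ 2.
  move=> ab; have [lt|lt|/val_inj eq] := ltngtP a b; last by rewrite eq eqxx in ab.
    by have : a%:R + 1 <= b%:R :> R by [rewrite natr1 ler_nat]; nra.
  by have : b%:R + 1 <= a%:R :> R by [rewrite natr1 ler_nat]; nra.
move: qq'; rewrite -pair_eqE negb_and => /orP[/far H|/far H].
  by rewrite (le_trans H)// lerDl sqr_ge0.
by rewrite (le_trans H)// lerDr sqr_ge0.
Qed.

(** On a cell f^2 differs from its value at the corner by at most [eta]; integrate over each cell
    and add up over disjoint cells inside [D]. *)
Let sum_le zeta (I : R) : nc zeta = 1 ->
  (\int[mu2]_(p in D) (sqmod (f (p.1 +i* p.2)))%:E = I%:E)%E ->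
  \sum_q nc (f (w + grid q * zeta) ^+ 2) <= I / h ^+ 2 + n%:R ^+ 2 * eta.
Proof.
move=> z1 HI.
pose g (p : T2) := sqmod (f (p.1 +i* p.2)).
have g0 p : 0 <= g p by rewrite /g -nc_sq sqr_ge0.
have mg (A : set T2) : measurable A -> measurable_fun A (fun p : T2 => (g p)%:E).
  move=> mA; apply/measurable_EFinP; apply: measurable_funTS.
  exact: measurable_sqmod_comp.
have mc q : measurable (cell zeta q) by exact: measurable_square.
have cell_le q : ((h ^+ 2 * nc (f (w + grid q * zeta) ^+ 2))%:E <=
    \int[mu2]_(p in cell zeta q) (g p)%:E + (h ^+ 2 * eta)%:E)%E.
  set z0 := w + grid q * zeta; have mE : mu2 (cell zeta q) = (h ^+ 2)%:E by exact: (lebesgue2_square _ _ (ltW h0)).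
  rewrite mulrC [h ^+ 2 * eta]mulrC (EFinM (nc _) (h ^+ 2)) (EFinM eta (h ^+ 2)) -mE.
  rewrite -!integral_cst// -ge0_integralD//; first last.
  - by move=> p _; rewrite lee_fin ltW.
  - exact: mg.
  - by move=> p _; rewrite lee_fin.
  apply: ge0_le_integral => //.
  - by move=> p _; rewrite lee_fin nc_ge0.
  - by apply: emeasurable_funD => //; exact: mg.
  move=> [x y] [/=]; rewrite !in_itv /= => /andP[x1 x2] /andP[y1 y2].
  rewrite -EFinD lee_fin /g /=.
  pose k : R[i] := (x - complex.Re z0) +i* (y - complex.Im z0).
  have kd : nc k <= del.
    rewrite (le_trans _ hdel)// (le_trans (nc_ReIm _))//= !ger0_norm ?subr_ge0//.
    by rewrite mulr_natl mulr2n lerD// lerBlDl ltW.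
  have zw : nc (z0 - w) <= 2 * r.
    rewrite /z0 [w + _]addrC addrK ncM z1 mulr1 (le_trans (grid_le q))//.
    by have := h0; have := r0; lra.
  have := unif zw kd.
  have -> : z0 + k = x +i* y.
    by rewrite /k; case: (z0) => a b; apply/eqP; rewrite eq_complex /= ![_ + (_ - _)]addrC !subrK !eqxx.
  move=> H; rewrite -nc_sq -ncX -[f z0 ^+ 2](subrK (f (x +i* y) ^+ 2)) (le_trans (ncD _ _))//.
  by rewrite addrC lerD2l -ncN opprB.
have S : (\sum_q (h ^+ 2 * nc (f (w + grid q * zeta) ^+ 2))%:E <= I%:E + (n%:R ^+ 2 * (h ^+ 2 * eta))%:E)%E.
  apply: (le_trans (lee_sum _ (fun q _ => cell_le q))).
  rewrite big_split /= sumEFin.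
  apply: leeD.
    rewrite -HI -ge0_integral_bigsetU//.
    + apply: ge0_subset_integral => //.
      * exact: bigsetU_measurable.
      * exact: measurable_square.
      * by apply: mg; exact: measurable_square.
      * by move=> p _; rewrite lee_fin.
      * elim/big_ind: _ => // [A B hA hB p [/hA|/hB]//|q _]; exact: cell_sub.
    + exact: index_enum_uniq.
    + by apply: sub_trivIset (cell_disj z1).
    + by apply: mg; exact: bigsetU_measurable.
    + by move=> p _; rewrite lee_fin.
  by rewrite lee_fin sumr_const card_prod !card_ord -[X in X <= _]mulr_natl natrM expr2.
move: S; rewrite sumEFin -EFinD lee_fin -mulr_sumr => S.
have h2 : 0 < h ^+ 2 by rewrite exprn_gt0.
rewrite -(ler_pM2l h2) [h ^+ 2 * (_ + _)]mulrDr (le_trans S)// [h ^+ 2 * (I / _)]mulrCA divff ?gt_eqF// mulr1.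
by rewrite lerD2l le_eqVlt; apply/orP; left; apply/eqP; ring.
Qed.

(** The sum [G] equals n^2 f(w)^2 at 0 and is bounded by [sum_le] on the unit circle. Multiplying by
    h^2 yields the constant, since n h = r / 4. *)
Lemma sub_mean_approx (I : R) :
  (\int[mu2]_(p in D) (sqmod (f (p.1 +i* p.2)))%:E = I%:E)%E ->
  r ^+ 2 / 16 * sqmod (f w) <= I + r ^+ 2 / 16 * eta.
Proof.
move=> HI.
pose F (q : 'I_n * 'I_n) (zeta : R[i]) := f (w + grid q * zeta) ^+ 2.
pose G zeta := \sum_q F q zeta.
have Gd : cdiff G.
  apply: cdiff_sum => q z; apply: cdiff_atM; exact: cdiff_affine_comp.
have H := @max_principle R G [set z | nc (z - 0) <= 1] [set z | nc (z - 0) < 1]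
  (I / h ^+ 2 + n%:R ^+ 2 * eta) (@compact_disc R 0 1) (@open_disc R 0 1) _ Gd.
have {H} : nc (G 0) <= I / h ^+ 2 + n%:R ^+ 2 * eta.
  apply: H => [z /= /ltW//|zeta|]; last by rewrite /= subrr nc0.
  rewrite /= subr0 => z1 /negP; rewrite -leNgt => z1'.
  have {z1 z1'}z1 : nc zeta = 1 by apply/eqP; rewrite eq_le z1.
  exact: le_trans (nc_sum _ _) (sum_le z1 HI).
have -> : G 0 = n%:R ^+ 2 * f w ^+ 2.
  rewrite /G /F; under eq_bigr do rewrite mulr0 addr0.
  by rewrite sumr_const card_prod card_ord -[LHS]mulr_natl natrM expr2.
have h2 : 0 < h ^+ 2 by rewrite exprn_gt0.
rewrite ncM !ncX [nc (f w) ^+ 2]nc_sq (_ : nc n%:R = n%:R); last first.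
  by rewrite -(rmorph_nat (real_complex R)) nc_real ger0_norm.
move=> H; have := ler_wpM2l (ltW h2) H.
rewrite [h ^+ 2 * (_ + n%:R ^+ 2 * eta)]mulrDr [h ^+ 2 * (I / _)]mulrCA divff ?gt_eqF// mulr1.
have -> : r ^+ 2 / 16 = h ^+ 2 * n%:R ^+ 2 by rewrite [in LHS]hr; move: h => hh; field.
by rewrite -!mulrA.
Qed.

End SubMean.

Lemma sub_mean f w r : cdiff f -> 0 < r ->
  ((r ^+ 2 / 16 * sqmod (f w))%:E <=
   \int[mu2]_(p in square (complex.Re w - r) (complex.Im w - r) (2 * r))
     (sqmod (f (p.1 +i* p.2)))%:E)%E.
Proof.
move=> fd r0; set J := integral _ _ _.
have J0 : (0 <= J)%E by apply: integral_ge0 => p _; rewrite lee_fin -nc_sq sqr_ge0.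
have [Joo|Jfin] := eqVneq J +oo%E; first by rewrite Joo leey.
have JE : J = (fine J)%:E by rewrite fineK// ge0_fin_numE// ltey.
rewrite JE lee_fin; apply/ler_addgt0Pr => e e0.
have r16 : 0 < r ^+ 2 / 16 by rewrite divr_gt0// exprn_gt0.
pose eta := e / (r ^+ 2 / 16); have eta0 : 0 < eta by rewrite divr_gt0.
have f2d : cdiff (fun z => f z ^+ 2) by move=> z; apply: cdiff_atM; exact: fd.
have [del del0 Hdel] := heine_cantor (@compact_disc R w (2 * r)) (cdiff_ccont f2d) eta0.
(* Then [n] exceeds r / del, and the cell diameter bound 2 h = r / (2 n) is at most [del]. *)
pose n := (Num.trunc (r / del)).+1.
have hd : 2 * (r / (4 * n%:R)) <= del.
  have n0 : 0 < n%:R :> R by rewrite ltr0n.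
  have : r / del < n%:R by exact: truncnS_gt.
  rewrite ltr_pdivrMr// => rn.
  rewrite mulrA ler_pdivrMr ?mulr_gt0//; nra.
have := @sub_mean_approx f w r eta del n fd r0 eta0 isT _ hd (fine J) JE.
rewrite (_ : _ * eta = e); last by rewrite /eta mulrC divfK// gt_eqF.
by apply=> z k zw; apply: Hdel.
Qed.

End PlaneMeasure.

(** * Weighted sesquilinear forms on the Fock space *)

Section WeightedForms.
Variable R : realType.
Notation nc := (@ComplexField.Normc.normc R).
Notation mu2 := (@lebesgue2 R).
Notation T2 := (measurableTypeR R * measurableTypeR R)%type.
Implicit Types (f h : R[i] -> R[i]) (u v W : R[i] -> R) (z w k : R[i]).

Definition rcont u := continuous (u : R[i]^o -> R).

Lemma rcontD u v : rcont u -> rcont v -> rcont (fun z => u z + v z).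
Proof. by move=> cu cv z; apply: (@cvgD R R R[i]^o (nbhs z)); [exact: cu|exact: cv]. Qed.

Lemma rcontM u v : rcont u -> rcont v -> rcont (fun z => u z * v z).
Proof. by move=> cu cv z; have h1 := cu z; have h2 := cv z; exact: (cvgM h1 h2). Qed.

Lemma rcont_cst (c : R) : rcont (fun=> c).
Proof. exact: (@cst_continuous R[i]^o R c). Qed.

Lemma rcontN u : rcont u -> rcont (fun z => - u z).
Proof. by move=> cu z; have h1 := cu z; exact: (cvgN h1). Qed.

Lemma rcont_Re f : ccont f -> rcont (fun z => complex.Re (f z)).
Proof. by move=> fc; exact: (lip_comp_continuous fc (@norm_ReB R)). Qed.

Lemma rcont_Im f : ccont f -> rcont (fun z => complex.Im (f z)).
Proof. by move=> fc; exact: (lip_comp_continuous fc (@norm_ImB R)). Qed.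

Lemma rcont_gauss : rcont (@gauss R).
Proof.
move=> z; have h := rcontN (sqmod_comp_continuous (@ccont_id R)) (x := z).
exact: (@continuous_comp R[i]^o R R _ expR z h (@continuous_expR R _)).
Qed.

Lemma sqmod_ge0 z : 0 <= sqmod z.
Proof. by rewrite -nc_sq sqr_ge0. Qed.

Lemma gauss_gt0 z : 0 < gauss z.
Proof. exact: expR_gt0. Qed.

Lemma gauss_le1 z : gauss z <= 1.
Proof. by rewrite /gauss -[leRHS]expR0 ler_expR oppr_le0 sqmod_ge0. Qed.

Definition gint u := mu2.-integrable [set: T2] (fun p : T2 => (u (p.1 +i* p.2))%:E).
Definition Rint u : R := Rintegral mu2 [set: T2] (fun p : T2 => u (p.1 +i* p.2)).

Lemma gint_measurable u : rcont u -> measurable_fun [set: T2] (fun p : T2 => (u (p.1 +i* p.2))%:E).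
Proof. by move=> cu; apply/measurable_EFinP; exact: continuous_measurable_plane. Qed.

Lemma gint_le u v : rcont u -> gint v -> (forall z, `|u z| <= v z) -> gint u.
Proof.
move=> cu iv uv; apply: (le_integrable _ (gint_measurable cu) _ iv) => // p _.
by rewrite /= lee_fin (le_trans (uv _))// ler_norm.
Qed.

Lemma gintD u v : gint u -> gint v -> gint (fun z => u z + v z).
Proof. by move=> iu iv; apply: eq_integrable (integrableD measurableT iu iv). Qed.

Lemma gintZ (c : R) u : gint u -> gint (fun z => c * u z).
Proof. by move=> iu; apply: eq_integrable (integrableZl measurableT c iu). Qed.

Lemma RintD u v : gint u -> gint v -> Rint (fun z => u z + v z) = Rint u + Rint v.
Proof. by move=> iu iv; rewrite /Rint RintegralD. Qed.

Lemma RintZ (c : R) u : gint u -> Rint (fun z => c * u z) = c * Rint u.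
Proof. by move=> iu; rewrite /Rint RintegralZl. Qed.

Lemma fock_gint f : fock f -> gint (fun z => sqmod (f z) * gauss z).
Proof.
move=> [fe ffin]; apply/integrableP; split.
  apply: (@gint_measurable (fun z => sqmod (f z) * gauss z)); apply: rcontM rcont_gauss.
  exact: (sqmod_comp_continuous (cdiff_ccont (entire_cdiff fe))).
apply: le_lt_trans ffin; rewrite /normF2; under eq_integral => p _.
  rewrite /= ger0_norm; last by rewrite mulr_ge0 ?sqmod_ge0// ltW// gauss_gt0.
  over.
by [].
Qed.

(** [reform] and [imform] are the real and imaginary parts of W f conj(h) exp(-|z|^2), spelled out
    so that integrability is domination of real functions. *)
Definition reform W f h z : R := W z *
  (complex.Re (f z) * complex.Re (h z) + complex.Im (f z) * complex.Im (h z)) * gauss z.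
Definition imform W f h z : R := W z *
  (complex.Im (f z) * complex.Re (h z) - complex.Re (f z) * complex.Im (h z)) * gauss z.
Definition form W f h : R[i] := Rint (reform W f h) +i* Rint (imform W f h).

Lemma rcont_reform W f h : rcont W -> ccont f -> ccont h -> rcont (reform W f h).
Proof.
move=> cW cf ch; apply: rcontM rcont_gauss; apply: rcontM cW _.
by apply: rcontD; apply: rcontM; (exact: rcont_Re || exact: rcont_Im).
Qed.

Lemma rcont_imform W f h : rcont W -> ccont f -> ccont h -> rcont (imform W f h).
Proof.
move=> cW cf ch; apply: rcontM rcont_gauss; apply: rcontM cW _.
apply: rcontD; first by apply: rcontM; [exact: rcont_Im|exact: rcont_Re].
by apply: rcontN; apply: rcontM; [exact: rcont_Re|exact: rcont_Im].
Qed.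

Lemma fock_ccont f : fock f -> ccont f.
Proof. by move=> [fe _]; exact: (cdiff_ccont (entire_cdiff fe)). Qed.

Section Bounded.
Variables (W : R[i] -> R) (B : R).
Hypotheses (cW : rcont W) (WB : forall z, `|W z| <= B).

Let B0 : 0 <= B. Proof. exact: le_trans (normr_ge0 _) (WB 0). Qed.

Let dom_gint f h : fock f -> fock h ->
  gint (fun z => B * (sqmod (f z) * gauss z + sqmod (h z) * gauss z)).
Proof. by move=> ff fh; apply: gintZ; apply: gintD; exact: fock_gint. Qed.

Lemma gint_reform f h : fock f -> fock h -> gint (reform W f h).
Proof.
move=> ff fh; apply: (gint_le _ (dom_gint ff fh)).
  by apply: rcont_reform; [exact: cW|exact: fock_ccont|exact: fock_ccont].
move=> z; rewrite /reform !normrM (ger0_norm (ltW (gauss_gt0 z))) -mulrA -mulrDl.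
rewrite ler_pM ?mulr_ge0 ?(ltW (gauss_gt0 z))//.
rewrite ler_wpM2r ?(ltW (gauss_gt0 z))// /sqmod.
case: (f z) (h z) => a b [c d] /=.
have := sqr_ge0 (a - c); have := sqr_ge0 (a + c).
have := sqr_ge0 (b - d); have := sqr_ge0 (b + d).
have := sqr_ge0 a; have := sqr_ge0 b; have := sqr_ge0 c; have := sqr_ge0 d.
by move=> *; rewrite ler_norml; apply/andP; split; lra.
Qed.

Lemma gint_imform f h : fock f -> fock h -> gint (imform W f h).
Proof.
move=> ff fh; apply: (gint_le _ (dom_gint ff fh)).
  by apply: rcont_imform; [exact: cW|exact: fock_ccont|exact: fock_ccont].
move=> z; rewrite /imform !normrM (ger0_norm (ltW (gauss_gt0 z))) -mulrA -mulrDl.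
rewrite ler_pM ?mulr_ge0 ?(ltW (gauss_gt0 z))//.
rewrite ler_wpM2r ?(ltW (gauss_gt0 z))// /sqmod.
case: (f z) (h z) => a b [c d] /=.
have := sqr_ge0 (b - c); have := sqr_ge0 (b + c).
have := sqr_ge0 (a - d); have := sqr_ge0 (a + d).
have := sqr_ge0 a; have := sqr_ge0 b; have := sqr_ge0 c; have := sqr_ge0 d.
by move=> *; rewrite ler_norml; apply/andP; split; lra.
Qed.

End Bounded.

Lemma formC W f h : gint (imform W f h) -> form W h f = (form W f h)^*.
Proof.
move=> ii; rewrite /form /=; congr (_ +i* _).
  by congr Rint; apply/funext => z; rewrite /reform; ring.
rewrite -[RHS]mulN1r -RintZ//; congr Rint; apply/funext => z; rewrite /imform; ring.
Qed.

Lemma Rint_complex_lin (c : R[i]) u v u' v' : gint u -> gint v -> gint u' -> gint v' ->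
  Rint (fun z => u' z + (complex.Re c * u z + (- complex.Im c) * v z)) +i*
  Rint (fun z => v' z + (complex.Re c * v z + complex.Im c * u z)) =
  (Rint u' +i* Rint v') + c * (Rint u +i* Rint v) :> R[i].
Proof.
move=> iu iv iu' iv'.
rewrite !RintD ?RintZ//; try by do ?[apply: gintD|apply: gintZ].
by case: c => c1 c2; apply/eqP; rewrite eq_complex /= mulNr !eqxx.
Qed.

Lemma formDZ W (B : R) f1 f2 h (c : R[i]) : rcont W -> (forall z, `|W z| <= B) ->
  fock f1 -> fock f2 -> fock h ->
  form W (fun z => f1 z + c * f2 z) h = form W f1 h + c * form W f2 h.
Proof.
move=> cW WB F1 F2 Fh.
rewrite -Rint_complex_lin; try by [exact: (gint_reform cW WB)|exact: (gint_imform cW WB)].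
rewrite /form; congr (_ +i* _); congr Rint; apply/funext => z; rewrite /reform /imform.
  by case: c (f1 z) (f2 z) => [c1 c2] [a1 a2] [b1 b2] /=; ring.
by case: c (f1 z) (f2 z) => [c1 c2] [a1 a2] [b1 b2] /=; ring.
Qed.

Lemma dotF_form f h : dotF f h = form (fun=> 1) f h.
Proof.
rewrite /dotF /Cintegral /form /Rint; congr (_ +i* _); congr Rintegral; apply/funext => p.
  by rewrite /reform; case: (f _) (h _) => a b [c d] /=; ring.
by rewrite /imform; case: (f _) (h _) => a b [c d] /=; ring.
Qed.

(** The product W f is in general not entire, so [formDZ] does not cover it; linearity is applied to
    the real integrands instead. *)
Lemma dotF_subZ W (B : R) f h (l : R[i]) : rcont W -> (forall z, `|W z| <= B) ->
  fock f -> fock h ->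
  dotF (fun z => (W z)%:C * f z - l * f z) h = form W f h - l * form (fun=> 1) f h.
Proof.
move=> cW WB Ff Fh.
have c1 : rcont (fun _ : R[i] => 1 : R) := @rcont_cst 1.
have b1 (z : R[i]) : `|(1 : R)| <= 1 by rewrite normr1.
rewrite -mulNr -Rint_complex_lin; first last.
- exact: (gint_imform cW WB).
- exact: (gint_reform cW WB).
- exact: (gint_imform c1 b1).
- exact: (gint_reform c1 b1).
rewrite /dotF /Cintegral /Rint; congr (_ +i* _); congr Rintegral; apply/funext => p.
  by rewrite /reform /imform; case: l (f _) (h _) => l1 l2 [a b] [c d] /=; ring.
by rewrite /reform /imform; case: l (f _) (h _) => l1 l2 [a b] [c d] /=; ring.
Qed.

Lemma form_diag W f : form W f f = (Rint (fun z => W z * (sqmod (f z) * gauss z)))%:C.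
Proof.
rewrite /form; apply/eqP; rewrite eq_complex /=; apply/andP; split; apply/eqP.
  by congr Rint; apply/funext => z; rewrite /reform /sqmod; ring.
rewrite (_ : imform W f f = fun=> 0); last by apply/funext => z; rewrite /imform; ring.
by rewrite /Rint /Rintegral integral0.
Qed.

Lemma cdiff_entire f : cdiff f -> entire f.
Proof.
move=> fd z; have [d Hd] := fd z; apply/cvg_ex; exists d.
apply/cvgrPdist_le => e e0.
have e0' : 0 < complex.Re e by move: e0; rewrite ltcE => /andP[].
have eE : e = (complex.Re e)%:C by rewrite RRe_real// gtr0_real.
have [r r0 Hr] := Hd _ e0'; rewrite near_withinE; apply/cnbhsP; exists r => // k.
rewrite subr0 => kr k0 /=; rewrite eE norm_nc lecR.
rewrite /GRing.scale /= mulr1 [k + z]addrC.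
have nk : 0 < nc k by rewrite nc_gt0.
rewrite -(ler_pM2r nk) -ncM -ncN.
have -> : - ((d - k^-1 * (f (z + k) - f z)) * k) = f (z + k) - f z - d * k by field.
exact: Hr.
Qed.

Lemma fockDZ f1 f2 (c : R[i]) : fock f1 -> fock f2 -> fock (fun z => f1 z + c * f2 z).
Proof.
move=> F1 F2.
have cd : cdiff (fun z => f1 z + c * f2 z).
  move=> z; apply: cdiff_atD; first exact: (entire_cdiff F1.1).
  by apply: cdiff_atM; [exact: cdiff_at_cst|exact: (entire_cdiff F2.1)].
split; first exact: cdiff_entire.
pose v z := 2 * (sqmod (f1 z) * gauss z) + 2 * sqmod c * (sqmod (f2 z) * gauss z).
have iv : gint v by apply: gintD; apply: gintZ; exact: fock_gint.
have iu : gint (fun z => sqmod (f1 z + c * f2 z) * gauss z).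
  apply: (gint_le _ iv).
    by apply: rcontM rcont_gauss; exact: (sqmod_comp_continuous (cdiff_ccont cd)).
  move=> z; have g0 := ltW (gauss_gt0 z).
  rewrite ger0_norm ?mulr_ge0 ?sqmod_ge0// /v !mulrA -mulrDl ler_wpM2r//.
  rewrite -[_ * sqmod c * _]mulrA -(nc_sq c) -(nc_sq (f2 z)) -exprMn -ncM nc_sq.
  by move: (f1 z) (c * f2 z) => [a1 a2] [b1 b2]; rewrite /sqmod /=;
    have := sqr_ge0 (a1 - b1); have := sqr_ge0 (a2 - b2); lra.
move/integrableP: iu => [_]; rewrite /normF2; under eq_integral => p _.
  rewrite /= ger0_norm; last by rewrite mulr_ge0 ?sqmod_ge0// ltW// gauss_gt0.
  over.
by [].
Qed.

Lemma fock0 : fock (fun=> 0 : R[i]).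
Proof.
split; first by apply: cdiff_entire => z; exact: cdiff_at_cst.
rewrite /normF2 (_ : (fun _ => _) = cst 0%E); first by rewrite integral0 ltry.
by apply/funext => p; rewrite /= /sqmod expr0n /= addr0 mul0r.
Qed.

End WeightedForms.

(** * Nonnegativity of the quadratic form *)

Section Positivity.
Variable R : realType.
Notation nc := (@ComplexField.Normc.normc R).
Notation mu2 := (@lebesgue2 R).
Notation T2 := (measurableTypeR R * measurableTypeR R)%type.
Implicit Types (f h : R[i] -> R[i]) (u v V : R[i] -> R) (z w k : R[i]).

Lemma rcont_ccont u : rcont u -> ccont (fun z => (u z)%:C).
Proof.
move=> cu z e e0.
have : nbhs (u z) (ball (u z) e) by exact: nbhsx_ballx.
move=> /(cu z) /cnbhsP[r r0 Hr]; exists r => // k kr.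
have := Hr (z + k); rewrite [z + k]addrC addrK => /(_ kr).
by rewrite /ball /= distrC -rmorphB /= nc_real => /ltW.
Qed.

Lemma square_nc w (r : R) (p : T2) : 0 < r ->
  square (complex.Re w - r) (complex.Im w - r) (2 * r) p -> nc (p.1 +i* p.2 - w) <= 2 * r.
Proof.
case: p => x y r0 [/=]; rewrite !in_itv /= => /andP[x1 x2] /andP[y1 y2].
rewrite (le_trans (nc_ReIm _))// !raddfB /= mulr_natl mulr2n.
move: x1 x2 y1 y2; rewrite mulr_natl mulr2n !addrA !subrK => x1 x2 y1 y2.
by apply: lerD; rewrite ler_distl ?x1 ?y1 ltW.
Qed.

Lemma gauss_ge z (B : R) : nc z <= B -> expR (- B ^+ 2) <= gauss z.
Proof.
move=> zB; rewrite /gauss ler_expR lerN2 -nc_sq ler_sqr ?nnegrE ?nc_ge0//.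
exact: le_trans (nc_ge0 z) zB.
Qed.

(** The mean value inequality with an integrand extended by 0 to the plane, ready for pointwise
    comparison. *)
Lemma sub_mean_restrict f w (r c : R) : cdiff f -> 0 < r -> 0 <= c ->
  let g : T2 -> \bar R := (fun p : T2 => (c * sqmod (f (p.1 +i* p.2)))%:E)
    \_ (square (complex.Re w - r) (complex.Im w - r) (2 * r)) in
  [/\ measurable_fun [set: T2] g, (forall p, 0 <= g p)%E &
    ((c * (r ^+ 2 / 16 * sqmod (f w)))%:E <= \int[mu2]_p g p)%E].
Proof.
move=> fd r0 c0 g.
have cs : rcont (fun z => sqmod (f z)) := sqmod_comp_continuous (cdiff_ccont fd).
have mg : measurable_fun [set: T2] (fun p : T2 => (c * sqmod (f (p.1 +i* p.2)))%:E).
  by apply: (@gint_measurable R (fun z => c * sqmod (f z))); apply: rcontM cs; exact: rcont_cst.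
have mS : measurable (square (complex.Re w - r) (complex.Im w - r) (2 * r) : set T2).
  exact: measurable_square.
split.
- by apply/(measurable_restrictT _ mS); exact: measurable_funTS.
- by move=> p; rewrite /g patchE; case: ifP => // _; rewrite lee_fin mulr_ge0// sqmod_ge0.
rewrite -integral_mkcond; under eq_integral do rewrite EFinM.
rewrite ge0_integralZl//; last 2 first.
- apply: measurable_funTS; exact: (gint_measurable cs).
- by move=> p _; rewrite lee_fin sqmod_ge0.
by rewrite EFinM lee_wpmul2l ?lee_fin//; exact: sub_mean.
Qed.

Lemma Rint_fin u : gint u -> (\int[mu2]_p (u (p.1 +i* p.2))%:E)%E = (Rint u)%:E.
Proof. by move=> iu; rewrite /Rint /Rintegral fineK//; exact: integrable_fin_num iu. Qed.

(** The mean value inequality with radius 1 bounds |f(w)|^2 at each point by a multiple of the norm;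
    the weight is bounded below because the square lies within distance 2 of [w]. *)
Lemma fock_norm_eq0 f : fock f -> Rint (fun z => sqmod (f z) * gauss z) <= 0 ->
  forall w, f w = 0.
Proof.
move=> Ff f0 w; have fd := entire_cdiff Ff.1.
have c0 : 0 < expR (- (nc w + 2) ^+ 2) by exact: expR_gt0.
have [mg g0 Hg] := sub_mean_restrict w fd ltr01 (ltW c0).
have iu := fock_gint Ff.
have : ((expR (- (nc w + 2) ^+ 2) * (1 ^+ 2 / 16 * sqmod (f w)))%:E <=
   (Rint (fun z => (sqmod (f z) * gauss z)%R))%:E)%E.
  rewrite -Rint_fin//; apply: (le_trans Hg); apply: ge0_le_integral => //.
    by move/integrableP: iu => [].
  move=> p _; rewrite patchE; case: ifPn => [|_]; last first.
    by rewrite lee_fin mulr_ge0 ?sqmod_ge0// ltW// gauss_gt0.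
  rewrite inE => /(square_nc ltr01) pw; rewrite lee_fin mulrC ler_wpM2l ?sqmod_ge0//.
  apply: gauss_ge; rewrite -[_ +i* _](subrK w) addrC (le_trans (ncD _ _))//.
  by rewrite lerD2l; rewrite mulr1 in pw.
rewrite lee_fin => /le_trans/(_ f0); rewrite pmulr_rle0// pmulr_rle0//.
move=> h; apply: ComplexField.Normc.eq0_normc; apply/eqP.
by rewrite -sqrf_eq0 nc_sq eq_le h sqmod_ge0.
Qed.

Section QuadraticForm.
Variables (V : R[i] -> R) (Gamma : set R[i]) (delta : R).
Hypotheses (cV : rcont V) (suppVc : compact (supp V : set R[i]^o))
  (Gc : compact (Gamma : set R[i]^o)) (G0 : exists w, Gamma w)
  (GV : Gamma `<=` supp V) (delta0 : 0 < delta)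
  (Vdelta : forall z, Gamma z -> delta <= V z)
  (Vneg : supp (neg_part V) `<=` inside Gamma).

Lemma supp_out z : ~ supp V z -> V z = 0.
Proof.
move=> sz; apply/eqP/negPn/negP => Vz; apply: sz.
exact: (@subset_closure R[i]^o).
Qed.

Lemma symbol_bounded : exists B : R, forall z, `|V z| <= B.
Proof.
have s0 : exists z, supp V z by have [w /GV] := G0; exists w.
have [c _ Hc] := compact_nc_max suppVc (rcont_ccont cV) s0.
exists (nc (V c)%:C) => z; have [sz|/supp_out ->] := pselect (supp V z).
  by rewrite -nc_real Hc.
by rewrite normr0 nc_ge0.
Qed.

Lemma neg_part_supp z : V z < 0 -> supp (neg_part V) z.
Proof.
move=> Vz; apply: (@subset_closure R[i]^o) => /=.
by rewrite /neg_part ltr0_norm//; apply/eqP; lra.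
Qed.

Lemma supp_neg_part_compact : compact (supp (neg_part V) : set R[i]^o).
Proof.
apply: (@subclosed_compact R[i]^o _ _ _ suppVc); first exact: closed_closure.
apply: (@closure_subset R[i]^o) => z /=; apply: contra => /eqP Vz.
by rewrite /neg_part Vz normr0 subr0 mul0r.
Qed.

Lemma form_ge0_off_finite : exists s : seq R[i], forall f, fock f ->
  (forall p, p \in s -> f p = 0) ->
  0 <= Rint (fun z => V z * (sqmod (f z) * gauss z)).
Proof.
have [Bv HBv] := symbol_bounded.
have Bv0 : 0 <= Bv := le_trans (normr_ge0 _) (HBv 0).
have [B HB] := compact_nc_bounded suppVc.
have B0 : 0 <= B by have [w /GV /HB] := G0; exact: le_trans (nc_ge0 _).
have d2 : 0 < delta / 2 by rewrite divr_gt0.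
have [del del0 Hdel] := heine_cantor Gc (rcont_ccont cV) d2.
(* The square about a point of [Gamma] reaches at most to distance 2 r = del, where V >= delta / 2;
   there [c] is a lower bound for V times the weight. *)
pose r := del / 2; have r0 : 0 < r by rewrite divr_gt0.
have rdel : 2 * r = del by rewrite /r; field.
pose c := expR (- (B + 2 * r) ^+ 2) * (delta / 2).
have c0 : 0 < c by rewrite mulr_gt0// expR_gt0.
(* The area of a box around the support of V; the margin 1 is there because squares are
   half-open. *)
pose A := (2 * (B + 1)) ^+ 2; have A0 : 0 <= A by exact: sqr_ge0.
(* Makes the negative contribution, at most Bv e |f(w)|^2 A, no larger than the gain c (r^2 / 16)
   |f(w)|^2; the 1 keeps the denominator positive. *)
pose e := c * (r ^+ 2 / 16) / (Bv * A + 1).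
have r16 : 0 < r ^+ 2 / 16 by rewrite divr_gt0// exprn_gt0.
have BA : 0 < Bv * A + 1 by rewrite ltr_wpDl// mulr_ge0.
have e0 : 0 < e by rewrite divr_gt0// mulr_gt0.
have eE : e * (Bv * A + 1) = c * (r ^+ 2 / 16) by rewrite /e mulfVK// gt_eqF.
clearbody e.
have [s Hs] := small_inside Gc supp_neg_part_compact Vneg e0.
exists s => f Ff fs; have fd := entire_cdiff Ff.1.
have [w Gw Hw] := compact_nc_max Gc (cdiff_ccont fd) G0.
have fneg z : V z < 0 -> sqmod (f z) <= e * sqmod (f w).
  by move=> /neg_part_supp Kz; rewrite -(nc_sq (f w)); exact: (Hs f fd fs _ Hw).
have [mg g0 Hg] := sub_mean_restrict w fd r0 (ltW c0).
set g := (X in measurable_fun _ X) in mg g0 Hg.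
have iu : gint (fun z => V z * (sqmod (f z) * gauss z)).
  apply: (gint_le _ (gintZ Bv (fock_gint Ff))).
    apply: rcontM cV _; apply: rcontM (@rcont_gauss R).
    exact: (sqmod_comp_continuous (cdiff_ccont fd)).
  move=> z; have h0 : 0 <= sqmod (f z) * gauss z.
    by rewrite mulr_ge0 ?sqmod_ge0// ltW// gauss_gt0.
  by rewrite normrM (ger0_norm h0) ler_wpM2r.
pose b := Bv * (e * sqmod (f w)).
have b0 : 0 <= b by apply: mulr_ge0 => //; apply: mulr_ge0; [exact: ltW|exact: sqmod_ge0].
pose box : set T2 := square (- (B + 1)) (- (B + 1)) (2 * (B + 1)).
have mbox : measurable box by exact: measurable_square.
have mubox : mu2 box = A%:E by apply: lebesgue2_square; lra.
pose v : T2 -> \bar R := (cst b%:E) \_ box.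
have v0 p : (0 <= v p)%E by rewrite /v patchE; case: ifP => // _; rewrite lee_fin.
have intv : (\int[mu2]_p v p = (b * A)%:E)%E.
  rewrite -integral_mkcond; transitivity (b%:E * mu2 box)%E; first exact: integral_cst.
  by rewrite mubox EFinM.
have iv : mu2.-integrable [set: T2] v.
  apply/integrableP; split.
    by apply/(measurable_restrictT _ mbox); exact: measurable_cst.
  by under eq_integral => p _ do rewrite gee0_abs//; rewrite intv ltry.
(* The inequality holds pointwise: on the square about [w] by the choice of [c], and elsewhere [g]
   is 0 while [v] compensates the points where V < 0. Adding [v] on the right keeps both integrands
   nonnegative. *)
have key : (\int[mu2]_p g p <= \int[mu2]_p ((V (p.1 +i* p.2) *
    (sqmod (f (p.1 +i* p.2)) * gauss (p.1 +i* p.2)))%:E + v p))%E.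
  apply: ge0_le_integral => //.
    by apply: emeasurable_funD; [case/integrableP: iu|case/integrableP: iv].
  move=> p _; set z : R[i] := p.1 +i* p.2.
  have h0 : 0 <= sqmod (f z) by exact: sqmod_ge0.
  have gz := gauss_gt0 z.
  rewrite {1}/g patchE; case: ifPn => [|_].
    rewrite inE => /(square_nc r0); rewrite -/z => zw.
    have Vz : delta / 2 <= V z.
      have := Hdel w (z - w) Gw; rewrite -rdel => /(_ zw).
      rewrite [w + _]addrC subrK -rmorphB /= nc_real ler_norml => /andP[h _].
      by have := Vdelta Gw; lra.
    have ge : expR (- (B + 2 * r) ^+ 2) <= gauss z.
      apply: gauss_ge; rewrite -[z](subrK w) addrC (le_trans (ncD _ _))// lerD//.
      exact/HB/GV.
    have h1 : c * sqmod (f z) <= V z * (sqmod (f z) * gauss z).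
      rewrite [sqmod (f z) * _]mulrC [leRHS]mulrA ler_wpM2r// /c [expR _ * _]mulrC.
      by apply: ler_pM => //; first [exact: expR_ge0|exact: ltW].
    by apply: (@le_trans _ _ (V z * (sqmod (f z) * gauss z))%:E); [rewrite lee_fin|exact: leeDl].
  have [Vz|Vz] := leP 0 (V z).
    by apply: adde_ge0; [rewrite lee_fin mulr_ge0// mulr_ge0// ltW|exact: v0].
  have zs : supp V z.
    by apply: contrapT => /supp_out E; move: Vz; rewrite E ltxx.
  have -> : v p = b%:E.
    rewrite /v patchE ifT// inE; have zB := HB z zs.
    have := le_trans (nc_Re z) zB; have := le_trans (nc_Im z) zB.
    rewrite !ler_norml /= => /andP[? ?] /andP[? ?].
    by split; rewrite /= in_itv /=; apply/andP; split; lra.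
  have h1 : - V z * (sqmod (f z) * gauss z) <= b.
    apply: ler_pM; [by rewrite oppr_ge0 ltW|by rewrite mulr_ge0// ltW| |].
      by rewrite -(ltr0_norm Vz).
    by apply: le_trans (fneg z Vz); rewrite ler_piMr//; exact: gauss_le1.
  have h2 : (0%:E <= (V z * (sqmod (f z) * gauss z))%:E + b%:E)%E.
    by rewrite -EFinD lee_fin addrC -lerBlDr sub0r -mulNr.
  exact: h2.
have := integralD measurableT iu iv; rewrite intv (Rint_fin iu) => intD.
have : (\int[mu2]_p g p <= (Rint (fun z => V z * (sqmod (f z) * gauss z)))%:E + (b * A)%:E)%E.
  by apply: (le_trans key); rewrite le_eqVlt; apply/orP; left; apply/eqP; exact: intD.
move=> /(le_trans Hg); rewrite -EFinD lee_fin.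
have : b * A <= c * (r ^+ 2 / 16 * sqmod (f w)).
  rewrite (_ : b * A = (e * (Bv * A)) * sqmod (f w)); last by rewrite /b; ring.
  rewrite [leRHS]mulrA ler_wpM2r ?sqmod_ge0//.
  by rewrite -eE ler_wpM2l ?lerDl// ltW.
by move=> /le_trans h1 /h1; rewrite lerDr.
Qed.

End QuadraticForm.
End Positivity.

(** * Negative eigenvalues *)

Section Eigenspaces.
Variable R : realType.
Implicit Types (f g h : R[i] -> R[i]) (V : R[i] -> R) (l : R[i]).

(** Induction on [s]: vanishing at one more point [p] lowers the dimension by at most one, and any
    [e0] in [E] with [e0 p != 0] supplies the missing generator. *)
Lemma finite_dim_eval (s : seq R[i]) (E : set (R[i] -> R[i])) :
  (forall f g c, E f -> E g -> E (fun z => f z + c * g z)) ->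
  (forall f, E f -> (forall p, p \in s -> f p = 0) -> forall z, f z = 0) ->
  finite_dim E.
Proof.
elim: s E => [|p s IH] E Elin Einj.
  exists 0%N, (fun _ _ => 0) => f Ef; exists (fun=> 0) => z.
  by rewrite big_ord0; apply: Einj.
have [||n [e He]] := IH [set f | E f /\ f p = 0].
- by move=> f g c [Ef fp] [Eg gp]; split; [exact: Elin|rewrite fp gp mulr0 addr0].
- move=> f [Ef fp] fs; apply: Einj => // q; rewrite inE => /predU1P[->//|]; exact: fs.
have [[e0 [Ee0 e0p]]|noe] := pselect (exists e0, E e0 /\ e0 p != 0); last first.
  exists n, e => f Ef; apply: He; split=> //.
  by apply/eqP/negPn/negP => fp; apply: noe; exists f.
exists n.+1, (fun k => if unlift ord0 k is Some j then e j else e0) => f Ef.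
have [|a Ha] := He (fun z => f z + (- (f p / e0 p)) * e0 z).
  by split; [exact: Elin|rewrite mulNr divfK// subrr].
exists (fun k => if unlift ord0 k is Some j then a j else f p / e0 p) => z.
rewrite big_ord_recl unlift_none; under eq_bigr do rewrite liftK.
by rewrite -Ha mulNr addrCA subrr addr0.
Qed.

Section Symbol.
Variables (V : R[i] -> R) (B : R).
Hypotheses (cV : rcont V) (VB : forall z, `|V z| <= B).

Lemma eigenspace_form l f : l != 0 -> eigenspaceT V l f ->
  fock f /\ forall h, fock h -> form V f h = l * form (fun=> 1) f h.
Proof.
move=> l0 [Ff Tf]; split=> // h Fh; apply/eqP; rewrite -subr_eq0; apply/eqP.
rewrite -(dotF_subZ l cV VB Ff Fh).
(* If the projection takes its default value 0, then l f = 0 with l != 0, so f = 0 and both sides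
   vanish. *)
move: Tf; rewrite /toeplitz /fock_proj; case: xgetP => [g _ [_ Hg] gE|_ f0].
  by rewrite gE in Hg; exact: Hg.
have {}f0 z : f z = 0.
  by have /esym/eqP := congr1 (fun u => u z) f0; rewrite mulf_eq0 (negbTE l0) => /eqP.
rewrite (_ : (fun _ => _) = fun=> 0); last by apply/funext => z; rewrite f0 !mulr0 subrr.
rewrite dotF_form /form /reform /imform /=.
rewrite (_ : Rint _ = 0); last first.
  rewrite /Rint (_ : (fun _ => _) = fun=> 0) ?/Rintegral ?integral0//.
  by apply/funext => p; rewrite !mul0r addr0 mulr0 mul0r.
rewrite (_ : Rint _ = 0)// /Rint (_ : (fun _ => _) = fun=> 0) ?/Rintegral ?integral0//.
by apply/funext => p; rewrite !mul0r subrr mulr0 mul0r.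
Qed.

Let one_cont : rcont (fun _ : R[i] => 1 : R) := @rcont_cst R 1.
Let one_le (z : R[i]) : `|1 : R| <= 1. Proof. by rewrite normr1. Qed.

Lemma form1_diag f : form (fun=> 1) f f = (Rint (fun z => sqmod (f z) * gauss z))%:C.
Proof.
rewrite form_diag; congr (_%:C); congr Rint.
by apply/funext => z; rewrite mul1r.
Qed.

Lemma form1C f h : fock f -> fock h -> form (fun=> 1) h f = (form (fun=> 1) f h)^*.
Proof. by move=> Ff Fh; apply: formC; exact: (gint_imform one_cont one_le). Qed.

Lemma formVC f h : fock f -> fock h -> form V h f = (form V f h)^*.
Proof. by move=> Ff Fh; apply: formC; exact: (gint_imform cV VB). Qed.

Variable s : seq R[i].
Hypothesis form_ge0 : forall f, fock f -> (forall p, p \in s -> f p = 0) ->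
  0 <= Rint (fun z => V z * (sqmod (f z) * gauss z)).

Lemma eigenspace_finite_dim l : l < 0 -> finite_dim (eigenspaceT V l).
Proof.
move=> l0; have ln0 : l != 0 by rewrite lt_eqF.
(* The weak eigenspace contains [eigenspaceT V l] and is visibly linear, whereas [toeplitz] is
   defined by a choice. *)
pose E : set (R[i] -> R[i]) :=
  [set f | fock f /\ forall h, fock h -> form V f h = l * form (fun=> 1) f h].
suff [n [e He]] : finite_dim E.
  by exists n, e => f /(eigenspace_form ln0) Ef; exact: He.
apply: (@finite_dim_eval s) => [f g c [Ff Hf] [Fg Hg]|f [Ff Hf] fs].
  split=> [|h Fh]; first exact: fockDZ.
  rewrite (formDZ c cV VB Ff Fg Fh) (formDZ c one_cont one_le Ff Fg Fh) Hf// Hg//.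
  by ring.
apply: (fock_norm_eq0 Ff).
have := Hf f Ff; rewrite form_diag form1_diag.
move: l0; rewrite ltcE; case: l {ln0 E Hf} => l1 l2 /= /andP[/eqP <-] l10.
move=> [E _]; have := form_ge0 Ff fs; rewrite E mul0r subr0.
by rewrite nmulr_rge0.
Qed.

Section DistinctEigenvalues.
Variables (m : nat) (l : 'I_m -> R[i]) (f : 'I_m -> R[i] -> R[i]).
Hypotheses (linj : injective l) (l0 : forall i, l i < 0)
  (fE : forall i, eigenspaceT V (l i) (f i)) (fn0 : forall i, exists z, f i z != 0).

Let Ff i : fock (f i). Proof. by case: (fE i). Qed.
Let fV i h : fock h -> form V (f i) h = l i * form (fun=> 1) (f i) h.
Proof. by have [_] := eigenspace_form (negbT (lt_eqF (l0 i))) (fE i); apply. Qed.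
Let lR i : (l i)^* = l i.
Proof.
by have := l0 i; rewrite ltcE; case: (l i) => a b /= /andP[/eqP <- _]; rewrite oppr0.
Qed.

Let conjM (x y : R[i]) : conjc (x * y) = conjc x * conjc y. Proof. exact: rmorphM. Qed.

(** Both forms are hermitian and the eigenvalues real, so the product (l i - l j) (f i, f j) is
    0. *)
Let orth i j : i != j -> form (fun=> 1) (f i) (f j) = 0.
Proof.
move=> ij; have h1 := fV i (Ff j); have := fV j (Ff i).
rewrite (formVC (Ff i) (Ff j)) h1 (form1C (Ff i) (Ff j)) conjM lR => /eqP.
rewrite -subr_eq0 -mulrBl mulf_eq0 subr_eq0 conjc_eq0 => /orP[/eqP/linj ijE|/eqP//].
by rewrite ijE eqxx in ij.
Qed.

Lemma fock_comb (I : seq 'I_m) (a : 'I_m -> R[i]) :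
  fock (fun z => \sum_(i <- I) a i * f i z).
Proof.
elim: I => [|i I IH].
  by rewrite (_ : (fun _ => _) = fun=> 0); [exact: fock0|apply/funext => z; rewrite big_nil].
rewrite (_ : (fun _ => _) = fun z => \sum_(j <- I) a j * f j z + a i * f i z).
  exact: fockDZ.
by apply/funext => z; rewrite big_cons addrC.
Qed.

Lemma form_comb W (C : R) (I : seq 'I_m) (a : 'I_m -> R[i]) h :
  rcont W -> (forall z, `|W z| <= C) -> fock h ->
  form W (fun z => \sum_(i <- I) a i * f i z) h = \sum_(i <- I) a i * form W (f i) h.
Proof.
move=> cW WC Fh; elim: I => [|i I IH].
  (* The empty combination F equals F + (-1) F, so its form equals its form minus itself. *)
  rewrite big_nil; have := formDZ (-1) cW WC (fock_comb [::] a) (fock_comb [::] a) Fh.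
  rewrite (_ : (fun z => _ + _) = fun z => \sum_(i <- [::]) a i * f i z).
    by move=> E; rewrite E mulN1r subrr.
  by apply/funext => z; rewrite big_nil mulr0 addr0.
rewrite (_ : (fun _ => _) = fun z => \sum_(j <- I) a j * f j z + a i * f i z).
  by rewrite (formDZ _ cW WC (fock_comb I a) (Ff i) Fh) IH big_cons addrC.
by apply/funext => z; rewrite big_cons addrC.
Qed.

(** Otherwise the evaluation matrix has more rows than columns, and a nonzero vector of its left
    kernel gives a combination [F] that vanishes on [s]. By orthogonality the form at [F] is the sum
    of l_i |a_i|^2 N_i, which is negative, against [form_ge0]. *)
Lemma distinct_eigenvalues_le : (m <= size s)%N.
Proof.
rewrite leqNgt; apply/negP => sm.
pose M : 'M[R[i]]_(m, size s) := \matrix_(i, j) f i s`_j.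
have : kermx M != 0.
  rewrite -mxrank_eq0 mxrank_ker subn_eq0 -ltnNge.
  exact: leq_ltn_trans (rank_leq_col M) sm.
move=> /rowV0Pn[a /sub_kermxP aM a0].
pose F z := \sum_(i < m) a 0 i * f i z.
have FF : fock F := fock_comb _ (fun i => a 0 i).
have Fs p : p \in s -> F p = 0.
  move=> ps; have ip : (index p s < size s)%N by rewrite index_mem.
  have := congr1 (fun A : 'rV_(size s) => A 0 (Ordinal ip)) aM.
  rewrite !mxE => <-; apply: eq_bigr => i _.
  by rewrite mxE /= nth_index.
pose N i := Rint (fun z => sqmod (f i z) * gauss z).
have N0 i : 0 < N i.
  rewrite ltNge; apply/negP => /(fock_norm_eq0 (Ff i)) fi0.
  by have [z] := fn0 i; rewrite fi0 eqxx.
have fF i : form (fun=> 1) (f i) F = conjc (a 0 i) * (N i)%:C.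
  rewrite (form1C FF (Ff i)) (form_comb _ _ one_cont one_le (Ff i)).
  rewrite (bigD1 i)//= big1 => [|j ji]; last by rewrite orth ?mulr0.
  by rewrite addr0 form1_diag conjM conjc_real.
have := form_ge0 FF Fs.
have -> : Rint (fun z => V z * (sqmod (F z) * gauss z)) =
    \sum_i complex.Re (l i) * (sqmod (a 0 i) * N i).
  have := form_diag V F; rewrite [in LHS]/F (form_comb _ _ cV VB FF).
  move=> /(congr1 (@complex.Re R)) /= <-; rewrite raddf_sum; apply: eq_bigr => i _ /=.
  rewrite fV// fF; have := l0 i; rewrite ltcE => /andP[/eqP + _].
  by case: (l i) (a 0 i) => l1 l2 [a1 a2] /= <-; rewrite /sqmod /=; ring.
have [i ai] : exists i, a 0 i != 0.
  apply: contrapT => na; move/eqP: a0; apply; apply/rowP => i; rewrite mxE.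
  by apply/eqP/negPn/negP => ai; apply: na; exists i.
have le0 j : complex.Re (l j) * (sqmod (a 0 j) * N j) <= 0.
  rewrite nmulr_rle0; last by have := l0 j; rewrite ltcE => /andP[].
  by rewrite mulr_ge0 ?sqmod_ge0// ltW.
apply/negP; rewrite -ltNge (bigD1 i)//= -[ltRHS]addr0 ltr_leD//; last first.
  exact: sumr_le0.
rewrite nmulr_rlt0; last by have := l0 i; rewrite ltcE => /andP[].
by rewrite mulr_gt0// -nc_sq exprn_gt0// nc_gt0.
Qed.

End DistinctEigenvalues.

Lemma eigenvalues_finite : finite_set [set l : R[i] | l < 0 /\ eigenvalueT V l].
Proof.
apply: contrapT => /(@infinite_set_fset _ _ (size s).+1)[A AE sA].
pose l (i : 'I_(size s).+1) := (finmap.enum_fset A)`_i.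
have lin i : l i \in finmap.enum_fset A by rewrite mem_nth// (leq_trans (ltn_ord i)).
have lP i : l i < 0 /\ eigenvalueT V (l i) by exact: AE (lin i).
have ex i : exists f, eigenspaceT V (l i) f /\ exists z, f z != 0.
  by have [_ [f h1 h2]] := lP i; exists f.
have [f Hf] := choice ex.
have linj : injective l.
  move=> i j /eqP; rewrite nth_uniq ?finmap.fset_uniq ?(leq_trans (ltn_ord _))// => /eqP.
  exact: val_inj.
have := distinct_eigenvalues_le linj (fun i => (lP i).1) (fun i => (Hf i).1) (fun i => (Hf i).2).
by rewrite ltnn.
Qed.

End Symbol.
End Eigenspaces.

Theorem theorem1p1 (R : realType) (V : R[i] -> R)
  (V_continuous : continuous (V : R[i]^o -> R))
  (V_compact_supp : compact (supp V : set R[i]^o))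
  (V_connected_supp : connected (supp V : set R[i]^o))
  (Gamma : set R[i]) (delta : R)
  (Gamma_curve : smooth_closed_simple_curve Gamma)
  (Gamma_supp : Gamma `<=` supp V)
  (delta_gt0 : 0 < delta)
  (V_ge_delta : forall z, Gamma z -> delta <= V z)
  (V_neg_inside : supp (neg_part V) `<=` inside Gamma) :
  finitely_many_negative_eigenvalues V.
Proof.
have [Gc G0] := smooth_closed_simple_curve_compact Gamma_curve.
have [B VB] := symbol_bounded V_continuous V_compact_supp G0 Gamma_supp.
have [s Hs] := form_ge0_off_finite V_continuous V_compact_supp Gc G0 Gamma_supp
  delta_gt0 V_ge_delta V_neg_inside.
split; first exact: (eigenvalues_finite V_continuous VB Hs).
by move=> l l0 _; exact: (eigenspace_finite_dim V_continuous VB Hs).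
Qed.
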